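(* Let $n\ge1$ be a fixed integer. For $k\ge1$ the linear operators $B_{-k}$ and $B_k$ of the Heisenberg algebra act on the Fock space $\mathbf{F}$ by $$B_{-k}|\lambda\rangle=\sum_\mu\mathcal{X}_k^{\mu/\lambda}(-q^{-1})\,|\mu\rangle,\qquad B_k|\lambda\rangle=\sum_\mu\mathcal{X}_k^{\lambda/\mu}(-q^{-1})\,|\mu\rangle$$ for every partition $\lambda$, where $\mathcal{X}_k^{\mu/\lambda}(q)=\sum_S(-1)^{h(S)}q^{s(S)}$, summed over all border ribbon strips $S$ of shape $\mu/\lambda$ and size $k$.
   Context: Ribbons: fix $n\ge1$. Partitions are identified with their Young diagrams (first row on top); ''connected'' means connected through edges. A ribbon is a connected skew shape with exactly $n$ squares containing no $2\times 2$ square; its spin is its number of rows minus 1. The spin of a shape tiled by ribbons is the sum of the spins of its ribbons. A horizontal ribbon strip is a skew shape tiled by ribbons such that the topright-most square of every ribbon touches the northern edge of the shape; such a tiling is unique if it exists, and $s(\lambda/\mu)$ denotes its spin. Fock space and Heisenberg action: $\mathbf{F}$ is the $\mathbb{C}(q)$-vector space with basis $|\lambda\rangle$, $\lambda$ a partition. The Heisenberg algebra with generators $B_k$, $k\in\mathbb{Z}\setminus\{0\}$, with $[B_k,B_{-k}]=k\frac{1-q^{-2nk}}{1-q^{-2k}}$ for $k\ge1$ and $[B_k,B_l]=0$ if $k+l\ne0$, acts on $\mathbf{F}$ (Kashiwara–Miwa–Stern; Lascoux–Leclerc–Thibon). The action is determined as follows: the commuting operators $\mathcal{V}_k|\lambda\rangle=\sum_\mu(-q)^{-s(\mu/\lambda)}|\mu\rangle$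 (over $\mu$ with $\mu/\lambda$ a horizontal ribbon strip with $k$ ribbons) and the commuting operators $\mathcal{U}_k|\lambda\rangle=\sum_\nu(-q)^{-s(\lambda/\nu)}|\nu\rangle$ (over $\nu$ with $\lambda/\nu$ a horizontal ribbon strip with $k$ ribbons) satisfy $\mathcal{V}_k=\sum_{\lambda\vdash k}z_\lambda^{-1}B_{-\lambda}$ and $\mathcal{U}_k=\sum_{\lambda\vdash k}z_\lambda^{-1}B_{\lambda}$, where $B_{\pm\lambda}=\prod_iB_{\pm\lambda_i}$ and $z_\lambda=\prod_i i^{m_i}m_i!$ with $m_i$ the multiplicity of $i$ in $\lambda$ (i.e. the relation expressing $h_k$ through the power sums $p_\lambda$). Border ribbon strips: a border ribbon strip $T$ is a connected skew shape $\lambda/\mu$ with a distinguished tiling by disjoint non-empty horizontal ribbon strips $T_1,\ldots,T_a$ (each with its ribbon tiling) such that $T_{+i}=\bigcup_{j\le i}T_j$ is a valid skew shape (of the form $\lambda^i/\mu$) for every $i$, $T_1$ is connected, and for each $i\ge2$ and each connected component $C$ of $T_i$: (1) the set of ribbons $C\cup T_{i-1}$ does not form a horizontal ribbon strip; (2) no proper sub horizontal ribbon strip $C'$ of $C$ (a subset of its ribbons) which can be added to the shape $T_{+(i-1)}$ (i.e. $T_{+(i-1)}\cup C'$ is a valid skew shape) has property (1), i.e. $C'\cup T_{i-1}$ forms a horizontal ribbon strip. The height $h(T_i)$ is the number of connected components of $T_i$, the height of $T$ is $h(T)=\left(\sum_i h(T_i)\right)-1$, its spin $s(T)$ is the sum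 of the spins of all its ribbons, and its size is its total number of ribbons. *)

(* Defs.v *)
From HB Require Import structures.
From mathcomp Require Import all_boot all_order all_algebra.
From mathcomp Require Import finmap.
From mathcomp Require Import boolp classical_sets cardinality fsbigop reals.
From mathcomp Require Import complex.
From mathcomp Require Import monalg.

Set Implicit Arguments.
Unset Strict Implicit.
Unset Printing Implicit Defensive.

Import GRing.Theory.

Local Open Scope fset_scope.
Local Open Scope ring_scope.

Record intpart : Type := IntPart {
  parts :> seq nat;
  _ : sorted geq parts && (0%N \notin parts)
}.
HB.instance Definition _ := [isSub for parts].
HB.instance Definition _ := [Countable of intpart by <:].

(* the square (i, j) lies in row i (counted from the top) and column j,
   both starting at 0 *)
Notation square := (nat * nat)%type.

Definition diagram (la : intpart) : {fset square} :=
  [fset x : square in [seq (i, j) | i <- iota 0 (size la),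
                                     j <- iota 0 (nth 0%N la i)]].

Definition contained (la mu : intpart) : bool := diagram la `<=` diagram mu.

(* meaningful when [contained la mu] *)
Definition skew_shape (mu la : intpart) : {fset square} :=
  diagram mu `\` diagram la.

Definition is_skew (D : {fset square}) : Prop :=
  exists mu la : intpart, contained la mu /\ D = skew_shape mu la.

Definition adjacent : rel square := fun x y =>
  ((x.1 == y.1) && ((x.2 == y.2.+1) || (y.2 == x.2.+1))) ||
  ((x.2 == y.2) && ((x.1 == y.1.+1) || (y.1 == x.1.+1))).

Definition linked (D : {fset square}) : rel D := connect (relpre val adjacent).

Definition edge_connected (D : {fset square}) : Prop :=
  forall x y : D, linked x y.

Definition components (D : {fset square}) : {fset {fset square}} :=
  [fset [fset val y | y : D & linked x y] | x : D].

Record ribbon (n : nat) (S : {fset square}) : Prop := Ribbon {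
  ribbon_skew : is_skew S;
  ribbon_connected : edge_connected S;
  ribbon_card : #|` S| = n;
  ribbon_no_2x2 : forall i j : nat,
    ~~ [&& (i, j) \in S, (i, j.+1) \in S, (i.+1, j) \in S & (i.+1, j.+1) \in S]
}.

Definition ribbon_spin (S : {fset square}) : nat :=
  #|` [fset x.1 | x in S]|.-1.

Definition is_top_right (S : {fset square}) (x : square) : Prop :=
  x \in S /\ forall y, y \in S -> (x.1 <= y.1)%N /\ (y.2 <= x.2)%N.

(* no square of D lies immediately above x *)
Definition touches_north (D : {fset square}) (x : square) : Prop :=
  forall i : nat, x.1 = i.+1 -> (i, x.2) \notin D.

Notation tiling := {fset {fset square}}.

Definition area (T : tiling) : {fset square} := (\bigcup_(S <- T) S)%fset.

Definition spin (T : tiling) : nat := (\sum_(S <- T) ribbon_spin S)%N.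

(* the set T of ribbons forms a horizontal ribbon strip *)
Record hstrip (n : nat) (T : tiling) : Prop := HStrip {
  hstrip_skew : is_skew (area T);
  hstrip_ribbon : forall S, S \in T -> ribbon n S;
  hstrip_disjoint : forall S S', S \in T -> S' \in T -> S != S' ->
    [disjoint S & S'];
  hstrip_north : forall S, S \in T -> forall x, is_top_right S x ->
    touches_north (area T) x
}.

Definition hstrip_tiling (n : nat) (mu la : intpart) (T : tiling) : Prop :=
  [/\ contained la mu, area T = skew_shape mu la & hstrip n T].

Definition is_hstrip (n k : nat) (mu la : intpart) : Prop :=
  exists T, hstrip_tiling n mu la T /\ #|` T| = k.

(* s(mu/la): the spin of the tiling chosen by [xget], the tiling being unique
   when it exists *)
Definition hstrip_spin (n : nat) (mu la : intpart) : nat :=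
  spin (xget fset0 [set T | hstrip_tiling n mu la T]%classic).

Definition areas (T : seq tiling) : {fset square} := (\bigcup_(U <- T) area U)%fset.

Definition ribbons_in (T : tiling) (C : {fset square}) : tiling :=
  [fset S in T | S `<=` C].

(* T = [:: T_1; ...; T_a]; [nth fset0 T i] is T_(i+1) and
   [areas (take i T)] is the union T_(+i) of T_1, ..., T_i *)
Record border_strip (n : nat) (mu la : intpart) (T : seq tiling) : Prop :=
  BorderStrip {
  border_contained : contained la mu;
  border_connected : edge_connected (skew_shape mu la);
  border_area : areas T = skew_shape mu la;
  border_nonnil : (0 < size T)%N;
  border_nonempty : forall i, (i < size T)%N -> nth fset0 T i != fset0;
  border_hstrip : forall i, (i < size T)%N -> hstrip n (nth fset0 T i);
  border_disjoint : forall i j, (i < j < size T)%N ->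
    [disjoint area (nth fset0 T i) & area (nth fset0 T j)];
  border_prefix : forall i, (i <= size T)%N ->
    exists nu, contained la nu /\ areas (take i T) = skew_shape nu la;
  border_first : edge_connected (area (nth fset0 T 0));
  border_attached : forall i, (0 < i < size T)%N ->
    forall C, C \in components (area (nth fset0 T i)) ->
    ~ hstrip n (ribbons_in (nth fset0 T i) C `|` nth fset0 T i.-1);
  border_minimal : forall i, (0 < i < size T)%N ->
    forall C, C \in components (area (nth fset0 T i)) ->
    forall C' : tiling, C' `<` ribbons_in (nth fset0 T i) C ->
    hstrip n C' ->
    (exists nu, contained la nu /\
       areas (take i T) `|` area C' = skew_shape nu la) ->
    hstrip n (C' `|` nth fset0 T i.-1)
}.

Definition border_height (T : seq tiling) : nat :=
  (\sum_(U <- T) #|` components (area U)|).-1.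

Definition border_spin (T : seq tiling) : nat := (\sum_(U <- T) spin U)%N.

Definition border_size (T : seq tiling) : nat := (\sum_(U <- T) #|` U|)%N.

(* The sums over classical sets below (\sum_(i \in A) F i from fsbigop) all
   have finite support. *)
Definition calX (A : comNzRingType) (n k : nat) (mu la : intpart) (x : A) : A :=
  \sum_(T \in [set T | border_strip n mu la T /\ border_size T = k]%classic)
    ((-1) ^+ border_height T * x ^+ border_spin T).

(* C(q), the complex numbers being R[i] *)
Notation Cq R := {fraction {poly (complex R)}}.

Definition qvar (R : realType) : Cq R := tofrac 'X.

Notation Fock R := {malg (Cq R)[intpart]}.

Definition ket (R : realType) (la : intpart) : Fock R := << la >>.

Definition fock_extend (R : realType) (f : intpart -> Fock R) (v : Fock R) :
  Fock R := \sum_(la <- msupp v) v@_la *: f la.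

Definition calV (R : realType) (n k : nat) : Fock R -> Fock R :=
  fock_extend (fun la => \sum_(mu \in [set mu | is_hstrip n k mu la]%classic)
    ((- qvar R) ^- hstrip_spin n mu la *: ket R mu)).

Definition calU (R : realType) (n k : nat) : Fock R -> Fock R :=
  fock_extend (fun la => \sum_(nu \in [set nu | is_hstrip n k la nu]%classic)
    ((- qvar R) ^- hstrip_spin n la nu *: ket R nu)).

Definition zee (la : intpart) : nat :=
  (\prod_(i <- undup la)
     (i ^ count_mem i la * (count_mem i la)`!))%N.

Definition operators (R : realType) : Type := int -> {linear Fock R -> Fock R}.

(* the value of B_0 is irrelevant: every clause of [heisenberg_action] only
   involves B_k with k nonzero *)
Definition Bprod (R : realType) (B : operators R) (la : intpart) :
  Fock R -> Fock R := foldr (fun i f => B i%:Z \o f) id la.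

Definition Bprod_neg (R : realType) (B : operators R) (la : intpart) :
  Fock R -> Fock R := foldr (fun i f => B (- i%:Z) \o f) id la.

Record heisenberg_action (R : realType) (n : nat) (B : operators R) : Prop :=
  HeisenbergAction {
  heisenberg_bracket : forall (k : nat) (v : Fock R), (0 < k)%N ->
    B k%:Z (B (- k%:Z) v) - B (- k%:Z) (B k%:Z v) =
    (k%:R * ((1 - qvar R ^- (2 * n * k)) / (1 - qvar R ^- (2 * k)))) *: v;
  heisenberg_commute : forall (k l : int) (v : Fock R),
    k != 0 -> l != 0 -> k + l != 0 -> B k (B l v) = B l (B k v);
  heisenberg_V : forall (k : nat) (v : Fock R), (0 < k)%N ->
    calV n k v = \sum_(la \in [set la : intpart | sumn la = k]%classic)
      ((zee la)%:R^-1 *: Bprod_neg B la v);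
  heisenberg_U : forall (k : nat) (v : Fock R), (0 < k)%N ->
    calU n k v = \sum_(la \in [set la : intpart | sumn la = k]%classic)
      ((zee la)%:R^-1 *: Bprod B la v)
}.

(* Main.v *)
(* The generating-function relations between V_k, U_k and the B_k amount to
   Newton's identity k h_k = sum_j h_(k-j) p_j, so by induction on k it suffices
   to prove this identity with p_j replaced by the operator whose coefficients
   count border ribbon strips.  The coefficient of a shape mu/la on the right is
   a signed sum over pairs (S, T), where S = (S_1, ..., S_a) is a border ribbon
   strip growing from la and T is a horizontal ribbon strip filling up mu.

   Order the ribbons of a horizontal strip R by their smallest content.  Call
   ideal of R a set of ribbons that can be added first.  Connected ideals are
   initial segments of the connected components of R, so that two of them are
   nested or far apart, and R has exactly |R| nonempty ones.  If R is added
   after S_b and R does not form a horizontal strip with S_b, the candidates for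
   components of S_(b+1) inside R are the minimal ideals M of R such that M does
   not form a horizontal strip with S_b; they are pairwise far apart, and
   S_(b+1) may be the union of any nonempty set of them.  Moving a chosen M from
   T to S_(b+1) or back changes the height by one and fixes the tiling, hence
   cancels all pairs except those with a = 1 and S_1, T forming a horizontal
   strip H.  In these S_1 is a nonempty connected ideal of H, which leaves
   |H| = k terms of weight given by the spin of H. *)

Require Import Defs.
From HB Require Import structures.
From mathcomp Require Import all_boot all_order all_algebra.
From mathcomp Require Import finmap.
From mathcomp Require Import boolp classical_sets cardinality fsbigop reals.
From mathcomp Require Import complex.
From mathcomp Require Import monalg.
From mathcomp Require Import zify.

Set Implicit Arguments.
Unset Strict Implicit.
Unset Printing Implicit Defensive.

Import Order.TTheory GRing.Theory Num.Theory.

(** * Shapes and connectivity *)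

(** The condition on a component of S_(b+1) looks back only at S_b, and this is what makes the
    cancellation possible: whether a part of R may become a component of the next strip depends on
    the chain below and on R alone, not on the other parts already moved. The ideal M can therefore
    be chosen independently of the moved part U, and moving it back and forth is an involution. It
    acts inside groups with s and R fixed, where U runs over all unions of candidates, the empty one
    included. A pair (S, T) that does not survive lies in exactly one group: U is empty if T touches
    the last strip of S, and otherwise U is that last strip.

    The resulting identity of coefficients mentions no operator, and it serves B_(-k) and B_k alike,
    by adding to or removing from the given shape. In both cases the term j = 0 of Newton's identity
    is the new operator, since h_0 = 1; the other terms are known by induction and cancel, so
    nothing has to be divided by k there. *)

Section Shapes.

Local Open Scope fset_scope.

Implicit Types (A C D E : {fset square}) (x y z : square) (la mu : intpart).

(** Finite down-sets of the quadrant are exactly the diagrams. Working with them allows shapes to be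
    built by unions, without constructing partitions. *)
Definition lower D :=
  forall x y, y \in D -> (x.1 <= y.1)%N -> (x.2 <= y.2)%N -> x \in D.

Lemma in_diagram la x : (x \in diagram la) = (x.2 < nth 0 la x.1)%N.
Proof.
rewrite /diagram !inE /=; apply/allpairsPdep/idP => [[i [j [_ jlt ->]]] | xlt].
  by move: jlt; rewrite mem_iota.
exists x.1, x.2; split; last by case: x {xlt}.
  rewrite mem_iota /= add0n ltnNge; apply/negP => le_x.
  by rewrite nth_default in xlt.
by rewrite mem_iota.
Qed.

Lemma nth_intpart_anti la i j : (i <= j)%N -> (nth 0 la j <= nth 0 la i)%N.
Proof.
move=> leij; have [le_j|lt_j] := leqP (size la) j; first by rewrite (nth_default _ le_j).
have /andP[srt _] := valP la.
have tr : transitive geq by move=> a b c; rewrite /geq /= => h h'; apply: leq_trans h' h.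
have := sorted_leq_nth tr leqnn 0 srt.
move=> /(_ i j); rewrite !inE; apply => //; exact: leq_ltn_trans lt_j.
Qed.

Lemma diagram_lower la : lower (diagram la).
Proof.
move=> x y; rewrite !in_diagram => ylt le1 le2.
apply: leq_ltn_trans le2 _; apply: leq_trans ylt _; exact: nth_intpart_anti.
Qed.

Lemma diagram_inj : injective diagram.
Proof.
move=> la mu eqD.
have eq_nth i : nth 0 la i = nth 0 mu i.
  apply/eqP; rewrite eqn_leq; apply/andP; split; rewrite leqNgt; apply/negP => lt.
    by have := in_diagram la (i, nth 0 mu i); rewrite /= lt eqD in_diagram /= ltnn.
  by have := in_diagram mu (i, nth 0 la i); rewrite /= lt -eqD in_diagram /= ltnn.
have size_gt0 (nu : intpart) i : (i < size nu)%N = (0 < nth 0 nu i)%N.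
  apply/idP/idP => [lt|]; last first.
    by apply: contraTT; rewrite -leqNgt => le; rewrite nth_default.
  have /andP[_ n0] := valP nu; rewrite lt0n; apply/eqP => e.
  by case/negP: n0; have := mem_nth 0 lt; rewrite e.
apply: val_inj; apply: (@eq_from_nth _ 0) => /= [|i _]; last exact: eq_nth.
apply/eqP; rewrite eqn_leq; apply/andP; split; rewrite leqNgt; apply/negP.
  by rewrite size_gt0 eq_nth -size_gt0 ltnn.
by rewrite size_gt0 -eq_nth -size_gt0 ltnn.
Qed.

Lemma fset_square_bound D :
  exists N, forall x, x \in D -> (x.1 < N)%N && (x.2 < N)%N.
Proof.
exists (\sum_(x <- D) (x.1 + x.2)).+1 => x xD.
by rewrite (big_rem x xD) /=; lia.
Qed.

(** The parts are the row lengths, cut off at the first row whose initial square is missing, so that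
    no part is 0. *)
Lemma lower_diagram D : lower D -> exists la, diagram la = D.
Proof.
move=> lowD; have [N bD] := fset_square_bound D.
have ex (i : nat) : exists j : nat, (i, j) \notin D.
  by exists N; apply/negP => /bD; rewrite /= ltnn andbF.
pose len i := ex_minn (ex i).
have lenP i j : ((i, j) \in D) = (j < len i)%N.
  rewrite /len; case: ex_minnP => m m_nD m_min; apply/idP/idP => [ijD|].
    rewrite ltnNge; apply/negP => le; case/negP: m_nD.
    exact: lowD ijD _ _.
  by apply: contraLR => /m_min; rewrite -leqNgt.
have exh : exists i : nat, (i, 0%N) \notin D.
  by exists N; apply/negP => /bD; rewrite /= ltnn.
pose h := ex_minn exh.
have len_gt0 i : (0 < len i)%N = (i < h)%N.
  rewrite -lenP /h; case: ex_minnP => m m_nD m_min; apply/idP/idP => [iD|].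
    rewrite ltnNge; apply/negP => le; case/negP: m_nD.
    exact: lowD iD _ _.
  by apply: contraLR => /m_min; rewrite -leqNgt.
have len_anti i : (len i.+1 <= len i)%N.
  case e : (len i.+1) => [//|m]; rewrite -lenP.
  by apply: (lowD _ (i.+1, m)); rewrite ?lenP ?e //=.
have ok : sorted geq (mkseq len h) && (0%N \notin mkseq len h).
  apply/andP; split.
    apply/(sortedP 0) => i; rewrite size_mkseq => lt.
    by rewrite !nth_mkseq //; [exact: len_anti | exact: ltnW].
  have pos_len : all (leq 1) (mkseq len h).
    by rewrite /mkseq all_map; apply/allP => i; rewrite mem_iota /= -len_gt0.
  by apply/negP => /(allP pos_len).
exists (IntPart ok); apply/fsetP => -[i j]; rewrite in_diagram lenP /=.
have [lt|le] := ltnP i h; first by rewrite nth_mkseq.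
rewrite nth_default ?size_mkseq //; move: (len_gt0 i).
by rewrite ltnNge leqn0 ltnNge le /=; case: eqP => // ->.
Qed.

Lemma card_diagram la : #|` diagram la| = sumn la.
Proof.
rewrite /diagram card_fseq undup_id; last first.
  apply: allpairs_uniq_dep => [|i _|]; rewrite ?iota_uniq //.
  by move=> [i j] [i' j'] _ _ /= [-> ->].
rewrite size_allpairs_dep.
rewrite -[in RHS](take_size la) -(map_nth_iota0 0 (leqnn (size la))).
by congr sumn; apply: eq_map => i; rewrite size_iota.
Qed.

End Shapes.

(** * Connectedness through unions of components *)

Section Connectivity.

Local Open Scope fset_scope.

Implicit Types (A C D E : {fset square}) (x y z : square).

(** These subsets are the unions of connected components of [D]; they replace paths in all arguments
    about connectedness. *)
Definition closed_in D A :=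
  A `<=` D /\ forall x y, x \in A -> y \in D -> adjacent x y -> y \in A.

Lemma adjacent_sym x y : adjacent x y = adjacent y x.
Proof. by case: x y => [i j] [i' j']; rewrite /adjacent /=; lia. Qed.

Lemma linked_connect_sym D : connect_sym (relpre (val : D -> square) adjacent).
Proof. by apply: sym_connect_sym => x y; rewrite /= adjacent_sym. Qed.

Lemma closed_linked D A (x y : D) :
  closed_in D A -> linked x y -> (val x \in A) = (val y \in A).
Proof.
move=> [_ cl] lxy.
apply: (closed_connect (a := [pred z : D | val z \in A]) _ lxy).
apply: intro_closed; first exact: linked_connect_sym.
by move=> u v /= auv uA; apply: cl auv => //; exact: valP.
Qed.

Definition component_of D (x : D) : {fset square} :=
  [fset val y | y : D & linked x y].

Lemma in_component_of D (x y : D) : (val y \in component_of x) = linked x y.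
Proof.
apply/imfsetP/idP => [[z /= lxz /val_inj ->] //|lxy].
by exists y.
Qed.

Lemma component_of_closed D (x : D) : closed_in D (component_of x).
Proof.
split; first by apply/fsubsetP => y /imfsetP[z _ ->]; exact: valP.
move=> y z /imfsetP[y' /= lxy ->] zD ayz.
have -> : z = val [` zD] by [].
rewrite in_component_of; apply: connect_trans lxy _.
exact: connect1.
Qed.

Lemma edge_connectedP D :
  edge_connected D <-> (forall A, closed_in D A -> A = fset0 \/ A = D).
Proof.
split=> [conn A clA|full x y].
  have [->|[x xA]] := fset_0Vmem A; first by left.
  right; apply/eqP; rewrite eqEfsubset (proj1 clA) /=; apply/fsubsetP => y yD.
  have xD := fsubsetP (proj1 clA) _ xA.
  have := conn [` xD] [` yD] => /(closed_linked clA) /= <-; exact: xA.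
have [e|e] := full _ (component_of_closed x).
  by have := in_component_of x x; rewrite e /linked connect0 inE.
by rewrite -in_component_of e; exact: valP.
Qed.

Lemma closed_connected_eq D A C : closed_in D A -> closed_in D C ->
  edge_connected C -> forall x, x \in A -> x \in C -> C `<=` A.
Proof.
move=> [sA clA] [sC clC] /edge_connectedP conn x xA xC.
have [|e|e] := conn (A `&` C).
- split; first exact: fsubsetIr.
  move=> y z /fsetIP[yA yC] zC ayz; apply/fsetIP; split => //.
  by apply: clA ayz => //; exact: (fsubsetP sC).
- by have : x \in A `&` C; [apply/fsetIP | rewrite e inE].
by apply/fsetIidPr.
Qed.

Lemma componentP D C :
  C \in components D <-> [/\ C != fset0, closed_in D C & edge_connected C].
Proof.
have connected_component (x : D) : edge_connected (component_of x).
  have clC := component_of_closed x.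
  apply/edge_connectedP => A clA.
  have [->|[y yA]] := fset_0Vmem A; first by left.
  right; apply/eqP; rewrite eqEfsubset (proj1 clA) /=; apply/fsubsetP => z.
  have yC := fsubsetP (proj1 clA) _ yA.
  have clDA : closed_in D A.
    split; first exact: (fsubset_trans (proj1 clA) (proj1 clC)).
    move=> u v uA vD auv; apply: (proj2 clA) (auv) => //.
    by apply: (proj2 clC) auv => //; exact: (fsubsetP (proj1 clA)).
  move=> /imfsetP[z' /= lxz ->]; move/imfsetP: yC => [y' /= lxy ey].
  by rewrite -(closed_linked clDA lxz) (closed_linked clDA lxy) /= -ey yA.
split=> [/imfsetP[x _ ->]|[]].
  rewrite -/(component_of x).
  split; [|exact: (component_of_closed x)|exact: connected_component].
  apply/fset0Pn; exists (val x); rewrite in_component_of; exact: connect0.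
move=> /fset0Pn[x xC] clC conn.
have xD := fsubsetP (proj1 clC) _ xC.
apply/imfsetP; exists [` xD] => //.
have clX := component_of_closed [` xD].
have xX : x \in component_of [` xD].
  by rewrite -[x]/(val [` xD]) in_component_of; exact: connect0.
apply/eqP; rewrite eqEfsubset.
rewrite (closed_connected_eq clX clC conn xX xC) /=.
exact: (closed_connected_eq clC clX (connected_component _) xC xX).
Qed.

Lemma component_cover D x : x \in D -> exists2 C, C \in components D & x \in C.
Proof.
move=> xD; exists (component_of [` xD]); first by apply/imfsetP; exists [` xD].
by rewrite -[x]/(val [` xD]) in_component_of; exact: connect0.
Qed.

Lemma closed_inD D A : closed_in D A -> closed_in D (D `\` A).
Proof.
move=> [sA clA]; split; first exact: fsubsetDl.
move=> x y /fsetDP[xD xA] yD axy; apply/fsetDP; split=> //.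
by apply: contra xA => yA; apply: clA yA xD _; rewrite adjacent_sym.
Qed.

(** A closed part of the union meets each of [A] and [C] in all or nothing, and the linking pair
    forces the same alternative for both. *)
Lemma connectedU A C : edge_connected A -> edge_connected C ->
  (exists x y, [/\ x \in A, y \in C & (x == y) || adjacent x y]) ->
  edge_connected (A `|` C).
Proof.
move=> /edge_connectedP cA /edge_connectedP cC [x [y [xA yC exy]]].
apply/edge_connectedP => E clE.
have sub X : X `<=` A `|` C -> closed_in X (E `&` X).
  move=> sX; split; first exact: fsubsetIr.
  move=> u v /fsetIP[uE uX] vX auv; apply/fsetIP; split=> //.
  by apply: (proj2 clE) auv => //; exact: (fsubsetP sX).
have inU u v : u \in E -> v \in A `|` C -> (u == v) || adjacent u v -> v \in E.
  by move=> uE vU /orP[/eqP <-//|]; apply: (proj2 clE).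
have eyx : (y == x) || adjacent y x by rewrite eq_sym adjacent_sym.
have sE := proj1 clE.
have [eA|eA] := cA _ (sub _ (fsubsetUl A C)).
  have xE : x \notin E.
    by apply/negP => xE; have : x \in E `&` A; [apply/fsetIP | rewrite eA inE].
  have [eC|eC] := cC _ (sub _ (fsubsetUr A C)).
    left; apply/fsetP => z; rewrite inE; apply/negP => zE.
    have /fsetUP[h|h] := fsubsetP sE _ zE.
      by have : z \in E `&` A; [apply/fsetIP | rewrite eA inE].
    by have : z \in E `&` C; [apply/fsetIP | rewrite eC inE].
  case/negP: xE; apply: (inU y) => //; last by apply/fsetUP; left.
  by move: yC; rewrite -eC => /fsetIP[].
have xE : x \in E by move: xA; rewrite -eA => /fsetIP[].
have yE : y \in E by apply: (inU x) => //; apply/fsetUP; right.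
right; have [eC|eC] := cC _ (sub _ (fsubsetUr A C)).
  by have : y \in E `&` C; [apply/fsetIP | rewrite eC inE].
apply/eqP; rewrite eqEfsubset sE /=; apply/fsubsetP => z /fsetUP[].
  by rewrite -eA => /fsetIP[].
by rewrite -eC => /fsetIP[].
Qed.

End Connectivity.

(** * Ribbons and horizontal strips *)

Section Ribbons.

Local Open Scope fset_scope.
Local Open Scope ring_scope.

Implicit Types (A C D E S : {fset square}) (x y z : square) (c d : int).

Lemma skew_convex D x y z : Defs.is_skew D -> x \in D -> z \in D ->
  (x.1 <= y.1 <= z.1)%N -> (x.2 <= y.2 <= z.2)%N -> y \in D.
Proof.
move=> [mu [la [_ ->]]] /fsetDP[_ xla] /fsetDP[zmu _] /andP[h1 h2] /andP[h3 h4].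
apply/fsetDP; split; first exact: (diagram_lower zmu _ _).
by apply: contra xla => yla; exact: (diagram_lower yla _ _).
Qed.

Lemma lower_skew D E : lower D -> lower E -> D `<=` E -> Defs.is_skew (E `\` D).
Proof.
move=> /lower_diagram[la <-] /lower_diagram[mu <-] s.
by exists mu, la.
Qed.

Definition content x : int := x.2%:Z - x.1%:Z.

Lemma square_eq x y : x.1 = y.1 -> x.2 = y.2 -> x = y.
Proof. by case: x y => [i j] [i' j'] /= -> ->. Qed.

Lemma adjacent_content x y : adjacent x y ->
  content y = content x + 1 \/ content x = content y + 1.
Proof. by case: x y => [i j] [i' j']; rewrite /adjacent /content /=; lia. Qed.

Lemma adjacent_step x y : adjacent x y -> content y = content x + 1 ->
  (y.1 = x.1 /\ y.2 = x.2.+1) \/ (x.1 = y.1.+1 /\ y.2 = x.2).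
Proof. by case: x y => [i j] [i' j']; rewrite /adjacent /content /=; lia. Qed.

(** A discrete intermediate value property: contents change by one along an edge, so without such an
    edge the squares of content at most [d] would be closed in [D]. *)
Lemma connected_crossing D x y d : edge_connected D -> x \in D -> y \in D ->
  content x <= d < content y ->
  exists u v, [/\ u \in D, v \in D, adjacent u v, content u = d &
                  content v = d + 1].
Proof.
move=> /edge_connectedP conn xD yD lexy; apply: contrapT => none.
have [|e|e] := conn [fset z in D | content z <= d].
- split; first by apply/fsubsetP => z; rewrite !inE => /andP[].
  move=> u v; rewrite !inE => /andP[uD leu] vD auv; rewrite vD /=.
  rewrite leNgt; apply/negP => ltv; apply: none; exists u, v.
  by have := adjacent_content auv; split=> //; lia.
- have : x \in [fset z in D | content z <= d] by rewrite !inE xD; lia.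
  by rewrite e inE.
- have : y \in [fset z in D | content z <= d] by rewrite e.
  by rewrite !inE; lia.
Qed.

Variable n : nat.

(** A ribbon read from its southwest end to its northeast end: one square on each of [n] consecutive
    diagonals from [c] on, each step going right or up. *)
Record content_path S c : Prop := ContentPath {
  path_range : forall x, x \in S -> c <= content x < c + n%:Z;
  path_onto : forall d, c <= d < c + n%:Z -> exists2 x, x \in S & content x = d;
  path_inj : forall x y, x \in S -> y \in S -> content x = content y -> x = y;
  path_step : forall x y, x \in S -> y \in S -> content y = content x + 1 ->
    (y.1 = x.1 /\ y.2 = x.2.+1) \/ (x.1 = y.1.+1 /\ y.2 = x.2)
}.

Lemma fset_minarg (T : choiceType) (A : {fset T}) (f : T -> int) : A != fset0 ->
  exists2 a : T, a \in A & forall b : T, b \in A -> f a <= f b.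
Proof.
move=> /fset0Pn[a0 a0A].
have [m _ h] := @Order.TotalTheory.arg_minP _ _ A [` a0A] predT (f \o val) isT.
exists (val m); first exact: valP.
by move=> b bA; exact: (h [` bA]).
Qed.

(** Two squares on one diagonal would, by convexity, produce a 2x2 square, so contents are distinct;
    connectedness makes them an interval and the cardinality gives its length. Squares on
    consecutive diagonals are adjacent because some edge crosses between these diagonals and each of
    them holds only one square. *)
Lemma ribbon_path S : ribbon n S -> exists c, content_path S c.
Proof.
case=> skew conn card no22.
have [S_eq0|S0] := eqVneq S fset0.
  (* Here n = 0, the range of contents is empty, and any starting content will do. *)
  exists 0; move: card; rewrite S_eq0 cardfs0 => n0.
  by split=> [x|d|x y|x y]; rewrite ?inE // -n0; lia.
have inj x y : x \in S -> y \in S -> content x = content y -> x = y.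
  wlog le : x y / (x.1 <= y.1)%N.
    by move=> W xS yS e; case: (leqP x.1 y.1) => h; [|symmetry]; apply: W => //; exact: ltnW.
  move: x y le => [i j] [i' j'] /= le xS yS e; rewrite /content /= in e.
  have [eii|lt] : i = i' \/ (i < i')%N by lia.
    by subst i'; have -> : j = j' by move: e; clear; lia.
  case/negP: (no22 i j); rewrite xS /=.
  by apply/and3P; split; apply: (skew_convex skew xS yS) => /=; lia.
have [a aS amin] := @fset_minarg _ S content S0.
have [b bS bmax] := @fset_minarg _ S (fun x => - content x) S0.
have {}bmax x : x \in S -> content x <= content b by move=> /bmax; lia.
have onto d : content a <= d <= content b -> exists2 x, x \in S & content x = d.
  move=> led; have [->|lt] : d = content b \/ d < content b by lia.
    by exists b.
  have [|u [v [uS _ _ <- _]]] := connected_crossing (d := d) conn aS bS; first by lia.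
  by exists u.
have eN : content b = content a + n%:Z - 1.
  have le_ab := amin _ bS.
  pose f x := `|content x - content a|%N.
  have finj : {in S &, injective f}.
    move=> x y xS yS; rewrite /f => e; apply: inj => //.
    by move: (amin _ xS) (amin _ yS) e; lia.
  have : #|` [fset f x | x in S]| = n by rewrite card_in_imfset.
  have -> : [fset f x | x in S] = [fset i in iota 0 (f b).+1].
    apply/fsetP => i; rewrite !inE mem_iota /=.
    apply/imfsetP/idP => [[x /= xS ->]|lt].
      by rewrite /f; move: (amin _ xS) (bmax _ xS); lia.
    have [|x xS ex] := onto (content a + i%:Z); first by rewrite /f in lt; lia.
    by exists x => //; rewrite /f; lia.
  by rewrite card_fseq undup_id ?iota_uniq // size_iota /f; lia.
exists (content a); split=> //.
- by move=> x xS; move: (amin _ xS) (bmax _ xS); lia.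
- by move=> d h; apply: onto; lia.
- move=> x y xS yS e.
  have [|u [v [uS vS auv eu ev]]] := connected_crossing (d := content x) conn xS yS.
    by lia.
  have eux := inj _ _ uS xS eu; have evy := inj _ _ vS yS (etrans ev (esym e)).
  by move: auv; rewrite eux evy => /adjacent_step; exact.
Qed.

(** The least content of a ribbon when n > 0; it orders the ribbons of a strip from left to
    right. *)
Definition pos S : int := xget 0 [set c | content_path S c]%classic.

Lemma posP S : ribbon n S -> content_path S (pos S).
Proof. by move=> /ribbon_path[c]; exact: xgetI. Qed.

Lemma pos_range S x : ribbon n S -> x \in S ->
  pos S <= content x < pos S + n%:Z.
Proof. by move=> /posP/path_range; exact. Qed.

Lemma pos_onto S d : ribbon n S -> pos S <= d < pos S + n%:Z ->
  exists2 x, x \in S & content x = d.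
Proof. by move=> /posP/path_onto; exact. Qed.

Lemma ribbon_neq0 S : (0 < n)%N -> ribbon n S -> S != fset0.
Proof. by move=> n_gt0 [_ _ card _]; rewrite -cardfs_gt0 card. Qed.

Lemma ribbon_mono S x y : ribbon n S -> x \in S -> y \in S ->
  content x <= content y -> (y.1 <= x.1)%N /\ (x.2 <= y.2)%N.
Proof.
move=> ribS xS yS; move: {2}(`|_ - _|%N) (erefl `|content y - content x|%N) => m.
elim: m y yS => [|m IH] y yS em le.
  by rewrite (path_inj (posP ribS) xS yS) //; lia.
have [z zS ez] : exists2 z, z \in S & content z = content y - 1.
  apply: pos_onto => //; move: (pos_range ribS xS) (pos_range ribS yS); lia.
have [||h1 h2] := IH z zS; [lia|lia|].
have := path_step (posP ribS) zS yS.
by move=> []; lia.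
Qed.

Lemma is_top_rightE S x : ribbon n S ->
  is_top_right S x <-> x \in S /\ content x = pos S + n%:Z - 1.
Proof.
move=> ribS; split=> [[xS top]|[xS ex]]; last first.
  split=> // y yS; apply: (ribbon_mono ribS yS xS).
  by rewrite ex; move: (pos_range ribS yS); lia.
split=> //; have [h hS eh] : exists2 h : square, h \in S & content h = pos S + n%:Z - 1.
  by apply: pos_onto => //; move: (pos_range ribS xS); lia.
have [t1 t2] : (x.1 <= h.1)%N /\ (h.2 <= x.2)%N := top _ hS.
by move: (pos_range ribS xS) eh; rewrite /content; lia.
Qed.

End Ribbons.

(** * Horizontal strips on a base shape, and ordering their ribbons by position *)

Section Strips.

Local Open Scope fset_scope.
Local Open Scope ring_scope.

Implicit Types (A C D E S : {fset square}) (x y z : square) (T I J : tiling).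

Lemma in_areaP T x : reflect (exists2 S, S \in T & x \in S) (x \in area T).
Proof.
rewrite /area; apply: (iffP (@bigfcupP _ _ _ _ _ _)) => [[S]|[S ST xS]].
  by rewrite andbT => ST xS; exists S.
by exists S; rewrite ?ST.
Qed.

Lemma in_area S T x : S \in T -> x \in S -> x \in area T.
Proof. by move=> ST xS; apply/in_areaP; exists S. Qed.

Lemma areaU I J : area (I `|` J) = area I `|` area J.
Proof.
apply/fsetP => x; apply/in_areaP/fsetUP => [[S /fsetUP[h|h] xS]|[]/in_areaP[S h xS]].
- by left; apply: in_area h xS.
- by right; apply: in_area h xS.
- by exists S => //; apply/fsetUP; left.
- by exists S => //; apply/fsetUP; right.
Qed.

Lemma area0 : area fset0 = fset0.
Proof. by rewrite /area big_seq_fset0. Qed.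

Lemma area_sub I J : I `<=` J -> area I `<=` area J.
Proof. by move=> /fsetUidPr <-; rewrite areaU; exact: fsubsetUl. Qed.

Lemma fsetUDl_sub (K : choiceType) (A B : {fset K}) : A `<=` B -> A `|` (B `\` A) = B.
Proof.
by move=> /fsubsetP sAB; apply/fsetP => a; rewrite !inE; case aA : (a \in A) => //=; rewrite sAB.
Qed.

Lemma fsetU_disjointDl (K : choiceType) (A B : {fset K}) :
  (forall a, a \in A -> a \in B -> False) -> (A `|` B) `\` A = B.
Proof.
move=> dis; apply/fsetP => a; rewrite !inE; case aA : (a \in A) => //=.
by case aB : (a \in B) => //; case: (dis a aA aB).
Qed.

Variable n : nat.

(* [hstrip] relative to the shape [D] on which it is added; by [is_top_rightE]
   the last clause is [hstrip_north]. *)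
Record strip D T : Prop := Strip {
  strip_base : lower D;
  strip_lower : lower (D `|` area T);
  strip_new : forall x, x \in D -> x \in area T -> False;
  strip_ribbon : forall S, S \in T -> ribbon n S;
  strip_disjoint : forall S S' x, S \in T -> S' \in T -> x \in S -> x \in S' ->
    S = S';
  strip_north : forall S x y, S \in T -> x \in S ->
    content x = pos n S + n%:Z - 1 -> y \in area T -> y.2 = x.2 ->
    x.1 <> y.1.+1
}.

Lemma strip_area_skew D T : strip D T -> Defs.is_skew (area T).
Proof.
move=> st; rewrite -(fsetU_disjointDl (strip_new st)).
apply: lower_skew; [exact: (strip_base st)|exact: (strip_lower st)|exact: fsubsetUl].
Qed.

Lemma strip_hstrip D T : strip D T -> hstrip n T.
Proof.
move=> st; split; first exact: (strip_area_skew st).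
- exact: (strip_ribbon st).
- move=> S S' ST S'T neq; apply/fdisjointP => x xS; apply/negP => xS'.
  by case/eqP: neq; exact: (strip_disjoint st ST S'T xS xS').
move=> S ST x /(is_top_rightE _ (strip_ribbon st ST))[xS ex] i ei.
apply/negP => h; exact: (strip_north st ST xS ex h).
Qed.

Lemma hstrip_strip D T : lower D -> lower (D `|` area T) ->
  (forall x, x \in D -> x \in area T -> False) -> hstrip n T -> strip D T.
Proof.
move=> lD lE new [_ rib dis north]; split=> //.
  move=> S S' x ST S'T xS xS'; apply/eqP/negPn/negP => neq.
  by have /fdisjointP/(_ _ xS)/negP := dis _ _ ST S'T neq.
move=> S x y ST xS ex yT e2 e1.
have top : is_top_right S x by apply/(is_top_rightE _ (rib _ ST)).
have /negP := north _ ST x top _ e1; apply.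
by rewrite -e2; case: y yT {e1 e2}.
Qed.

Definition ideal D T I := I `<=` T /\ lower (D `|` area I).

Lemma ideal_area_lower D T I x y : strip D T -> ideal D T I -> y \in area I ->
  x \in area T -> (x.1 <= y.1)%N -> (x.2 <= y.2)%N -> x \in area I.
Proof.
move=> st [_ low] yI xT h1 h2.
have /fsetUP[xD|//] : x \in D `|` area I.
  by apply: low h1 h2; apply/fsetUP; right.
by case: (strip_new st xD xT).
Qed.

Lemma area_mem D T I S x : strip D T -> I `<=` T -> S \in T -> x \in S ->
  x \in area I -> S \in I.
Proof.
move=> st sIT ST xS /in_areaP[S' S'I xS'].
by rewrite (strip_disjoint st ST (fsubsetP sIT _ S'I) xS xS').
Qed.

Lemma idealU D T I J : ideal D T I -> ideal D T J -> ideal D T (I `|` J).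
Proof.
move=> [sI lI] [sJ lJ]; split; first by rewrite fsubUset sI.
rewrite areaU => x y /fsetUP[yD|/fsetUP[yI|yJ]] h1 h2.
- have /fsetUP[h|h] : x \in D `|` area I by apply: lI h1 h2; apply/fsetUP; left.
    by apply/fsetUP; left.
  by apply/fsetUP; right; apply/fsetUP; left.
- have /fsetUP[h|h] : x \in D `|` area I by apply: lI h1 h2; apply/fsetUP; right.
    by apply/fsetUP; left.
  by apply/fsetUP; right; apply/fsetUP; left.
- have /fsetUP[h|h] : x \in D `|` area J by apply: lJ h1 h2; apply/fsetUP; right.
    by apply/fsetUP; left.
  by apply/fsetUP; right; apply/fsetUP; right.
Qed.

Lemma strip_sub D T I : strip D T -> I `<=` T -> lower (D `|` area I) ->
  strip D I.
Proof.
move=> st sI lI; have sA := fsubsetP (area_sub sI); split=> //.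
- exact: (strip_base st).
- by move=> x xD /sA; exact: (strip_new st xD).
- by move=> S /(fsubsetP sI); exact: (strip_ribbon st).
- by move=> S S' x /(fsubsetP sI) h /(fsubsetP sI); exact: (strip_disjoint st).
by move=> S x y /(fsubsetP sI) h xS ex /sA; exact: (strip_north st h xS ex).
Qed.

Lemma strip_ideal D T I : strip D T -> ideal D T I -> strip D I.
Proof. by move=> st [sI lI]; exact: (strip_sub st sI lI). Qed.

Lemma strip_diff D T I : strip D T -> ideal D T I ->
  strip (D `|` area I) (T `\` I).
Proof.
move=> st [sI lI]; have sD := fsubsetDl T I; have sA := fsubsetP (area_sub sD).
split=> //.
- by rewrite -fsetUA -areaU fsetUDl_sub //; exact: (strip_lower st).
- move=> x /fsetUP[xD /sA|xI /in_areaP[S /fsetDP[ST /negP SI] xS]].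
    exact: (strip_new st xD).
  by apply: SI; exact: (area_mem st sI ST xS).
- by move=> S /(fsubsetP sD); exact: (strip_ribbon st).
- by move=> S S' x /(fsubsetP sD) h /(fsubsetP sD); exact: (strip_disjoint st).
by move=> S x y /(fsubsetP sD) h xS ex /sA; exact: (strip_north st h xS ex).
Qed.

(* Convexity would put the square north of the head in the strip. *)
Lemma head_first D T S x y : strip D T -> S \in T -> x \in S ->
  content x = pos n S + n%:Z - 1 -> y \in area T ->
  (y.1 < x.1)%N -> (y.2 <= x.2)%N -> False.
Proof.
move=> st ST xS ex yT lt1 le2.
pose u : square := (x.1.-1, x.2).
have uT : u \in area T.
  by apply: (skew_convex (strip_area_skew st) yT (in_area ST xS)) => /=; lia.
by apply: (strip_north st ST xS ex uT) => /=; lia.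
Qed.

(** The heads of [S] and [S'] lie on one diagonal; if they differed, one would be strictly southeast
    of the other, against [head_first]. *)
Lemma pos_inj D T S S' : strip D T -> S \in T -> S' \in T ->
  (0 < n)%N -> pos n S = pos n S' -> S = S'.
Proof.
move=> st ST S'T n_gt0 e.
have rS := strip_ribbon st ST; have rS' := strip_ribbon st S'T.
have [h hS eh] : exists2 h : square, h \in S & content h = pos n S + n%:Z - 1.
  by apply: (pos_onto rS); lia.
have [h' hS' eh'] : exists2 h : square, h \in S' & content h = pos n S' + n%:Z - 1.
  by apply: (pos_onto rS'); lia.
have ehh : content h = content h' by lia.
have [lt|[lt|eq1]] : (h.1 < h'.1)%N \/ (h'.1 < h.1)%N \/ h.1 = h'.1 by lia.
- case: (head_first st S'T hS' eh' (in_area ST hS) lt).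
  by move: ehh; rewrite /content; lia.
- case: (head_first st ST hS eh (in_area S'T hS') lt).
  by move: ehh; rewrite /content; lia.
have ee : h = h'.
  by apply: square_eq => //; move: ehh eq1; rewrite /content; lia.
by apply: (strip_disjoint st ST S'T hS); rewrite ee.
Qed.

(** [S'] has a square on the diagonal just after the head of [S]. By [head_first] that square cannot
    lie above the head, so the head is weakly northwest of it and is added no later. *)
Lemma ideal_pos D T I S S' : strip D T -> ideal D T I -> S \in T -> S' \in I ->
  pos n S < pos n S' <= pos n S + n%:Z -> S \in I.
Proof.
move=> st idI ST S'I lt.
have S'T := fsubsetP (proj1 idI) _ S'I.
have rS := strip_ribbon st ST; have rS' := strip_ribbon st S'T.
have [h hS eh] : exists2 h : square, h \in S & content h = pos n S + n%:Z - 1.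
  by apply: (pos_onto rS); lia.
have [v vS' ev] : exists2 v : square, v \in S' & content v = pos n S + n%:Z.
  by apply: (pos_onto rS'); lia.
apply: (area_mem st (proj1 idI) ST hS).
apply: (ideal_area_lower st idI (in_area S'I vS') (in_area ST hS)).
  rewrite leqNgt; apply/negP => lt1.
  by apply: (head_first st ST hS eh (in_area S'T vS') lt1); move: eh ev; rewrite /content; lia.
have [lt1|le1] := ltnP v.1 h.1; last by move: eh ev; rewrite /content; lia.
case: (head_first st ST hS eh (in_area S'T vS') lt1).
by move: eh ev; rewrite /content; lia.
Qed.

Lemma adjacent_pos S S' x y : ribbon n S -> ribbon n S' -> x \in S -> y \in S' ->
  adjacent x y -> pos n S' <= pos n S + n%:Z.
Proof.
move=> rS rS' xS yS' /adjacent_content.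
by move: (pos_range rS xS) (pos_range rS' yS'); lia.
Qed.

(* Two disjoint ribbons cannot cross: once [S'] is above [S] on a diagonal it
   stays above up to the head of [S], contradicting [head_first]. *)
Lemma strip_no_crossing D T S S' x y : strip D T -> S \in T -> S' \in T ->
  S <> S' -> x \in S -> y \in S' -> content x = content y -> (y.1 < x.1)%N ->
  pos n S <= pos n S' -> False.
Proof.
move=> st ST S'T neq xS yS' e lt le.
have rS := strip_ribbon st ST; have rS' := strip_ribbon st S'T.
move: {2}(absz _) (erefl (absz (pos n S + n%:Z - 1 - content x)%R)) => m.
elim: m x y xS yS' e lt => [|m IH] x y xS yS' e lt em.
  have ex : content x = pos n S + n%:Z - 1 by move: (pos_range rS xS); lia.
  apply: (head_first st ST xS ex (in_area S'T yS') lt).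
  by move: e lt; rewrite /content; lia.
have [x' x'S ex'] : exists2 z : square, z \in S & content z = content x + 1.
  by apply: (pos_onto rS); move: (pos_range rS xS); lia.
have [y' y'S' ey'] : exists2 z : square, z \in S' & content z = content x + 1.
  by apply: (pos_onto rS'); move: (pos_range rS xS) (pos_range rS' yS'); lia.
have stx := path_step (posP rS) xS x'S ex'.
have sty : (y'.1 = y.1 /\ y'.2 = y.2.+1) \/ (y.1 = y'.1.+1 /\ y'.2 = y.2).
  by apply: (path_step (posP rS') yS' y'S'); lia.
have [lt'|eq1] : (y'.1 < x'.1)%N \/ y'.1 = x'.1 by move: e ex' ey' stx sty lt; rewrite /content; lia.
  by apply: (IH x' y') => //; move: (pos_range rS x'S); lia.
apply: neq; apply: (strip_disjoint st ST S'T x'S).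
suff -> : x' = y' by [].
by apply: square_eq => //; move: ex' ey'; rewrite /content; lia.
Qed.

(** Any square weakly northwest of another is reached by unit steps north and west, and all these
    steps stay in [D] or [E]. *)
Lemma lowerU_step D E A : lower D -> lower (D `|` E) -> A `<=` E ->
  (forall x y, y \in A -> x \in E ->
    (x.1 = y.1 /\ y.2 = x.2.+1) \/ (y.1 = x.1.+1 /\ x.2 = y.2) -> x \in A) ->
  lower (D `|` A).
Proof.
move=> lD lE sAE step x y.
have inU z z' : z' \in D `|` A -> (z.1 <= z'.1)%N -> (z.2 <= z'.2)%N ->
    (z.1 = z'.1 /\ z'.2 = z.2.+1) \/ (z'.1 = z.1.+1 /\ z.2 = z'.2) -> z \in D `|` A.
  move=> /fsetUP[z'D|z'A] h1 h2 adj; apply/fsetUP.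
    by left; exact: (lD _ _ z'D h1 h2).
  have /fsetUP[zD|zE] : z \in D `|` E; [|by left|by right; exact: (step _ _ z'A zE adj)].
  by apply: (lE z z') => //; apply/fsetUP; right; exact: (fsubsetP sAE).
move: {2}(_ - _)%N (erefl ((y.1 + y.2) - (x.1 + x.2))%N) => m.
elim: m x y => [|m IH] x y em yU h1 h2.
  suff -> : x = y by [].
  by apply: square_eq; lia.
have [lt|ge] := ltnP x.1 y.1.
  apply: (IH _ (y.1.-1, y.2)) => /=; try lia.
  by apply: (inU (y.1.-1, y.2) y) => //=; lia.
apply: (IH _ (y.1, y.2.-1)) => /=; try lia.
by apply: (inU (y.1, y.2.-1) y) => //=; lia.
Qed.

(** Suppose a square y of [S] has its north or west neighbour x in a later ribbon [S']. If x is
    north of y, then y is not a head, so [S] continues to the diagonal of x; if x is west of y, then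
    [S'] continues to the diagonal of y. Either way the two ribbons share a square or [S'] passes
    above [S], which [strip_no_crossing] forbids. *)
Lemma pos_ideal D T c : strip D T ->
  ideal D T [fset S in T | pos n S <= c].
Proof.
move=> st; set I := [fset S in T | _].
have sI : I `<=` T by apply/fsubsetP => S; rewrite !inE => /andP[].
split=> //.
have step x y : y \in area I -> x \in area T -> 
    (x.1 = y.1 /\ y.2 = x.2.+1) \/ (y.1 = x.1.+1 /\ x.2 = y.2) -> x \in area I.
  move=> /in_areaP[S SI yS] /in_areaP[S' S'T xS'] adj; apply/in_areaP; exists S' => //.
  move: (SI); rewrite !inE S'T => /andP[ST leS] /=.
  rewrite leNgt; apply/negP => ltS'.
  have neq : S <> S' by move=> e; move: leS ltS'; rewrite e; lia.
  have rS := strip_ribbon st ST; have rS' := strip_ribbon st S'T.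
  have yx : content x = content y + 1 \/ content x = content y - 1.
    by move: adj; rewrite /content; lia.
  have [ex|ex] := yx.
    have e2 : x.2 = y.2 /\ y.1 = x.1.+1 by move: adj ex; rewrite /content; lia.
    have [eh|neh] := eqVneq (content y) (pos n S + n%:Z - 1).
      by case: (strip_north st ST yS eh (in_area S'T xS')); case: e2.
    have [y' y'S ey'] : exists2 z : square, z \in S & content z = content y + 1.
      by apply: (pos_onto rS); move: (pos_range rS yS) neh; lia.
    have sty : (y'.1 = y.1 /\ y'.2 = y.2.+1) \/ (y.1 = y'.1.+1 /\ y'.2 = y.2).
      exact: (path_step (posP rS) yS y'S).
    have [lt|eq1] : (x.1 < y'.1)%N \/ y' = x.
    - case: sty => sty; [left|right]; first by lia.
      by apply: square_eq; lia.
    - by apply: (strip_no_crossing st ST S'T neq y'S xS' _ lt); lia.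
    by apply: neq; apply: (strip_disjoint st ST S'T y'S); rewrite eq1.
  have e2 : x.1 = y.1 /\ y.2 = x.2.+1 by move: adj ex; rewrite /content; lia.
  have [x' x'S' ex'] : exists2 z : square, z \in S' & content z = content y.
    by apply: (pos_onto rS'); move: (pos_range rS yS) (pos_range rS' xS'); lia.
  have stx : (x'.1 = x.1 /\ x'.2 = x.2.+1) \/ (x.1 = x'.1.+1 /\ x'.2 = x.2).
    by apply: (path_step (posP rS') xS' x'S'); lia.
  have [lt|eq1] : (x'.1 < y.1)%N \/ x' = y.
  - case: stx => stx; [right|left]; last by lia.
    by apply: square_eq; lia.
  - by apply: (strip_no_crossing st ST S'T neq yS x'S' _ lt); lia.
  by apply: neq; apply: (strip_disjoint st ST S'T yS); rewrite -eq1.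
apply: lowerU_step (strip_base st) (strip_lower st) (area_sub sI) step.
Qed.

End Strips.

(** * Ideals of a horizontal strip *)

Section Ideals.

Local Open Scope fset_scope.
Local Open Scope ring_scope.

Implicit Types (A C D E S : {fset square}) (x y z : square).
Implicit Types (T I J K L M B U : tiling).

Variables (n : nat) (n_gt0 : (0 < n)%N).

(** In a connected strip the gaps between positions can be bridged: an edge leaves the ribbons up to
    the position of [S] and enters one that is at most [n] further right. That ribbon is in [I] by
    induction on the distance to [S'], and [ideal_pos] then gives [S]. *)
Lemma strip_ideal_pos D T I S S' : strip n D T -> edge_connected (area T) ->
  ideal D T I -> S \in T -> S' \in I -> pos n S < pos n S' -> S \in I.
Proof.
move=> st /edge_connectedP conn idI ST S'I; move: ST.
move: {2}(absz _) (erefl (absz (pos n S' - pos n S)%R)) => m.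
elim/ltn_ind: m S => m IH S em ST lt.
have S'T := fsubsetP (proj1 idI) _ S'I.
have [le|gt] := leP (pos n S') (pos n S + n%:Z).
  by apply: (ideal_pos st idI ST S'I); lia.
pose A := area [fset Q in T | pos n Q <= pos n S].
have inA Q x : Q \in T -> x \in Q -> (x \in A) = (pos n Q <= pos n S).
  move=> QT xQ; apply/in_areaP/idP => [[Q']|le].
    by rewrite !inE => /andP[Q'T le] xQ'; rewrite (strip_disjoint st QT Q'T xQ xQ').
  by exists Q => //; rewrite !inE QT.
have sA : A `<=` area T.
  by apply: area_sub; apply/fsubsetP => Q; rewrite !inE => /andP[].
have : ~ closed_in (area T) A.
  have /fset0Pn[x xS] := ribbon_neq0 n_gt0 (strip_ribbon st ST).
  have /fset0Pn[y yS'] := ribbon_neq0 n_gt0 (strip_ribbon st S'T).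
  move=> /conn[e|e].
    by have := inA _ _ ST xS; rewrite e inE; lia.
  by have := inA _ _ S'T yS'; rewrite e (in_area S'T yS'); lia.
apply: contra_notP => SI; split=> // x y xA yT adj.
apply: contrapT => /negP yA.
have /in_areaP[Q1 Q1T xQ1] := fsubsetP sA _ xA.
have /in_areaP[Q2 Q2T yQ2] := yT.
rewrite (inA _ _ Q1T xQ1) in xA; rewrite (inA _ _ Q2T yQ2) in yA.
have := adjacent_pos (strip_ribbon st Q1T) (strip_ribbon st Q2T) xQ1 yQ2 adj.
move=> le12.
have Q2I : Q2 \in I.
  have [ltQ|geQ] := ltP (pos n Q2) (pos n S'); last by exfalso; move: le12 xA gt geQ; clear; lia.
  by apply: (IH (absz (pos n S' - pos n Q2)%R) _ Q2) => //; rewrite -em; move: yA ltQ lt; clear; lia.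
by apply: (SI (ideal_pos st idI ST Q2I _)); move: le12 xA yA; clear; lia.
Qed.

(* Nested or far apart: in the ideal [I `|` J], which is connected, ideals are
   initial segments for the order by position. *)
Lemma connected_ideals_nested D T I J : strip n D T -> ideal D T I ->
  ideal D T J -> edge_connected (area (I `|` J)) -> I `<=` J \/ J `<=` I.
Proof.
move=> st idI idJ conn.
have stK := strip_ideal st (idealU idI idJ).
have idKI : ideal D (I `|` J) I by split; [exact: fsubsetUl | exact: (proj2 idI)].
have idKJ : ideal D (I `|` J) J by split; [exact: fsubsetUr | exact: (proj2 idJ)].
have [|/fsubsetPn[S SI SJ]] := boolP (I `<=` J); first by left.
right; apply/fsubsetP => S' S'J.
have SK : S \in I `|` J by apply/fsetUP; left.
have S'K : S' \in I `|` J by apply/fsetUP; right.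
have [lt|gt|e] := ltgtP (pos n S) (pos n S').
- by case/negP: SJ; exact: (strip_ideal_pos stK conn idKJ SK S'J lt).
- exact: (strip_ideal_pos stK conn idKI S'K SI gt).
by rewrite -(pos_inj stK SK S'K n_gt0 e).
Qed.

Lemma area_eq0 D T : strip n D T -> area T = fset0 -> T = fset0.
Proof.
move=> st e; have [//|[S ST]] := fset_0Vmem T.
have /fset0Pn[x xS] := ribbon_neq0 n_gt0 (strip_ribbon st ST).
by have := in_area ST xS; rewrite e inE.
Qed.

Lemma min_pos_singleton D T S : strip n D T -> S \in T ->
  (forall S', S' \in T -> pos n S <= pos n S') -> ideal D T [fset S].
Proof.
move=> st ST min; have -> : [fset S] = [fset S' in T | pos n S' <= pos n S].
  apply/fsetP => S'; rewrite !inE; apply/eqP/andP => [->|[S'T le]]; first by rewrite lexx.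
  by apply: (pos_inj st S'T ST n_gt0); apply/eqP; rewrite eq_le le min.
exact: pos_ideal.
Qed.

Lemma area1 S : area [fset S] = S.
Proof.
apply/fsetP => x; apply/in_areaP/idP => [[S']|xS]; first by rewrite inE => /eqP ->.
by exists S => //; rewrite inE.
Qed.

(* Peel off the leftmost ribbon: it consists of the northwest-most squares of
   its diagonals. *)
Lemma strip_unique D T T' : strip n D T -> strip n D T' -> area T = area T' ->
  T = T'.
Proof.
move: {2}(#|` T|) (erefl #|` T|) => m.
elim: m D T T' => [|m IH] D T T' em st st' eA.
  have T0 : T = fset0 by apply/cardfs0_eq.
  by rewrite T0; symmetry; apply: (area_eq0 st'); rewrite -eA T0 area0.
have T_neq0 : T != fset0 by rewrite -cardfs_gt0 em.
have [S ST minS] := fset_minarg (pos n) T_neq0.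
have T'_neq0 : T' != fset0.
  apply: contra_neq T_neq0 => T'0; apply: (area_eq0 st).
  by rewrite eA T'0 area0.
have [S' S'T minS'] := fset_minarg (pos n) T'_neq0.
(* The position of the leftmost ribbon is the least content in the area, hence the same for both
   tilings. *)
have half T1 T2 S1 S2 : strip n D T1 -> strip n D T2 -> area T1 = area T2 ->
    S1 \in T1 -> (forall Q, Q \in T1 -> pos n S1 <= pos n Q) ->
    S2 \in T2 -> pos n S1 <= pos n S2.
  move=> st1 st2 e12 S1T min1 S2T.
  have r2 := strip_ribbon st2 S2T.
  have [x xS2 ex] : exists2 x : square, x \in S2 & content x = pos n S2.
    by apply: (pos_onto r2); lia.
  have /in_areaP[Q QT xQ] : x \in area T1 by rewrite e12; exact: (in_area _ xS2).
  by rewrite -ex (le_trans (min1 _ QT)) //; case/andP: (pos_range (strip_ribbon st1 QT) xQ).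
have epos : pos n S = pos n S'.
  by apply/eqP; rewrite eq_le (half _ _ _ _ st st' eA ST minS S'T)
     (half _ _ _ _ st' st (esym eA) S'T minS' ST).
have idS := min_pos_singleton st ST minS.
have idS' := min_pos_singleton st' S'T minS'.
have sub T1 T2 S1 S2 : strip n D T1 -> strip n D T2 -> S1 \in T1 -> S2 \in T2 ->
    pos n S1 = pos n S2 -> lower (D `|` S1) -> lower (D `|` S2) -> S1 `<=` S2.
  move=> st1 st2 S1T S2T e12 l1 l2.
  suff s12 (x : square) : x \in S1 -> x \in S2 by exact/fsubsetP.
  move=> xS1.
  have r1 := strip_ribbon st1 S1T; have r2 := strip_ribbon st2 S2T.
  have [y yS2 ey] : exists2 y : square, y \in S2 & content y = content x.
    by apply: (pos_onto r2); move: (pos_range r1 xS1); lia.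
  suff -> : x = y by [].
  have [le|lt] := leqP x.1 y.1.
    have /fsetUP[xD|xS2] : x \in D `|` S2.
    - by apply: (l2 x y) => //; [apply/fsetUP; right|move: ey; rewrite /content; lia].
    - by case: (strip_new st1 xD (in_area S1T xS1)).
    exact: (path_inj (posP r2) xS2 yS2 (esym ey)).
  have /fsetUP[yD|yS1] : y \in D `|` S1.
  - by apply: (l1 y x) => //; [apply/fsetUP; right|exact: ltnW|move: ey; rewrite /content; lia].
  - by case: (strip_new st2 yD (in_area S2T yS2)).
  exact: (path_inj (posP r1) xS1 yS1 (esym ey)).
have lS : lower (D `|` S) by have := proj2 idS; rewrite area1.
have lS' : lower (D `|` S') by have := proj2 idS'; rewrite area1.
have eS : S = S'.
  apply/eqP; rewrite eqEfsubset (sub _ _ _ _ st st' ST S'T epos lS lS').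
  by rewrite (sub _ _ _ _ st' st S'T ST (esym epos) lS' lS).
have st1 := strip_diff st idS; have st1' := strip_diff st' idS'.
rewrite -(fsetUDl_sub (proj1 idS)) -(fsetUDl_sub (proj1 idS')) -eS; congr (_ `|` _).
rewrite -eS in st1'; apply: IH st1 st1' _.
  have := cardfsD1 S T; rewrite ST em => -[->].
  by congr (#|` _|).
apply/fsetP => x; apply/in_areaP/in_areaP => -[Q /fsetDP[QT QS] xQ].
  have /in_areaP[Q' Q'T xQ'] : x \in area T' by rewrite -eA; exact: (in_area _ xQ).
  exists Q' => //; apply/fsetDP; split=> //; apply: contra QS; rewrite !inE => /eqP eQ'.
  by apply/eqP; apply: (strip_disjoint st QT ST xQ); rewrite -eQ'.
have /in_areaP[Q' Q'T xQ'] : x \in area T by rewrite eA; exact: (in_area _ xQ).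
exists Q' => //; apply/fsetDP; split=> //; apply: contra QS; rewrite !inE => /eqP eQ'.
by apply/eqP; rewrite eS; rewrite eS in eQ'; apply: (strip_disjoint st' QT S'T xQ); rewrite -eQ'.
Qed.

End Ideals.

(** * Components of a strip, and the minimal ideals touching the previous strip *)

Section Blocks.

Local Open Scope fset_scope.
Local Open Scope ring_scope.

Implicit Types (A C D E S : {fset square}) (x y z : square).
Implicit Types (T I J K L M B U R : tiling).

Variables (n : nat) (n_gt0 : (0 < n)%N).

Definition blocks T : {fset tiling} :=
  [fset ribbons_in T C | C in components (area T)].

Record is_block T B : Prop := IsBlock {
  block_sub : B `<=` T;
  block_neq0 : B != fset0;
  block_closed : closed_in (area T) (area B);
  block_connected : edge_connected (area B)
}.

(** Ribbons are connected, so no union of components cuts through one; components of squares thus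
    correspond to sets of ribbons. *)
Lemma closed_ribbon D T C S x : strip n D T -> closed_in (area T) C ->
  S \in T -> x \in S -> x \in C -> S `<=` C.
Proof.
move=> st [sC clC] ST xS xC.
have /edge_connectedP conn := ribbon_connected (strip_ribbon st ST).
have [|e|e] := conn (C `&` S).
- split; first exact: fsubsetIr.
  move=> y z /fsetIP[yC yS] zS adj; apply/fsetIP; split=> //.
  by apply: clC adj => //; exact: (in_area _ zS).
- by have : x \in C `&` S; [apply/fsetIP | rewrite e inE].
by apply/fsetIidPr.
Qed.

Lemma area_ribbons_in D T C : strip n D T -> closed_in (area T) C ->
  area (ribbons_in T C) = C.
Proof.
move=> st clC; apply/fsetP => x; apply/in_areaP/idP => [[S]|xC].
  by rewrite !inE => /andP[_ /fsubsetP]; exact.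
have /in_areaP[S ST xS] := fsubsetP (proj1 clC) _ xC.
by exists S => //; rewrite !inE ST (closed_ribbon st clC ST xS xC).
Qed.

Lemma blocksP D T B : strip n D T -> B \in blocks T <-> is_block T B.
Proof.
move=> st; split=> [/imfsetP[C /= /componentP[C0 clC conn] ->]|[sB B0 clB conn]].
  have e := area_ribbons_in st clC.
  split; rewrite ?e //.
    by apply/fsubsetP => S; rewrite !inE => /andP[].
  by apply: contra_neq C0 => B0; rewrite -e B0 area0.
apply/imfsetP; exists (area B) => /=.
  apply/componentP; split=> //; have [S SB] := fset0Pn _ B0.
  have /fset0Pn[x xS] := ribbon_neq0 n_gt0 (strip_ribbon st (fsubsetP sB _ SB)).
  by apply/fset0Pn; exists x; exact: (in_area _ xS).
apply/fsetP => S; rewrite !inE; apply/idP/andP => [SB|[ST sS]].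
  by split; [exact: (fsubsetP sB)|apply/fsubsetP => x; exact: in_area].
have /fset0Pn[x xS] := ribbon_neq0 n_gt0 (strip_ribbon st ST).
exact: (area_mem st sB ST xS (fsubsetP sS _ xS)).
Qed.

Lemma card_blocks D T : strip n D T -> #|` blocks T| = #|` components (area T)|.
Proof.
move=> st; apply: card_in_imfset => C C' /componentP[_ clC _] /componentP[_ clC' _] e.
by rewrite -(area_ribbons_in st clC) e (area_ribbons_in st clC').
Qed.

Lemma block_cover D T S : strip n D T -> S \in T ->
  exists2 B, is_block T B & S \in B.
Proof.
move=> st ST; have /fset0Pn[x xS] := ribbon_neq0 n_gt0 (strip_ribbon st ST).
have [C CT xC] := component_cover (in_area ST xS).
exists (ribbons_in T C); first by apply/(blocksP _ st)/imfsetP; exists C.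
have /componentP[_ clC _] := CT.
by rewrite !inE ST (closed_ribbon st clC ST xS xC).
Qed.

Lemma block_eq D T B B' : strip n D T -> is_block T B -> is_block T B' ->
  (exists2 S, S \in B & S \in B') -> B = B'.
Proof.
move=> st bB bB' [S SB SB'].
have ST := fsubsetP (block_sub bB) _ SB.
have /fset0Pn[x xS] := ribbon_neq0 n_gt0 (strip_ribbon st ST).
have half B1 B2 : is_block T B1 -> is_block T B2 -> S \in B1 -> S \in B2 ->
    B1 `<=` B2.
  move=> b1 b2 S1 S2; apply/fsubsetP => Q Q1.
  have QT := fsubsetP (block_sub b1) _ Q1.
  have /fset0Pn[y yQ] := ribbon_neq0 n_gt0 (strip_ribbon st QT).
  apply: (area_mem st (block_sub b2) QT yQ).
  apply: (fsubsetP (closed_connected_eq (block_closed b2) (block_closed b1)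
    (block_connected b1) (in_area S2 xS) (in_area S1 xS))).
  exact: (in_area _ yQ).
by apply/eqP; rewrite eqEfsubset !half.
Qed.

(** The north and west neighbours of a square are adjacent to it, so those inside the strip belong
    to the same component. *)
Lemma closed_ideal D T B : strip n D T -> B `<=` T ->
  closed_in (area T) (area B) -> ideal D T B.
Proof.
move=> st sB [sA clB]; split=> //.
apply: lowerU_step (strip_base st) (strip_lower st) sA _ => x y yB xT adj.
apply: clB yB xT _; case: x y adj => [i j] [i' j']; rewrite /adjacent /=; clear; lia.
Qed.

Lemma block_ideal D T B : strip n D T -> is_block T B -> ideal D T B.
Proof. by move=> st [sB _ clB _]; exact: closed_ideal. Qed.

Lemma ideal_trans D T U I : ideal D T U -> ideal D U I -> ideal D T I.
Proof. by move=> [sU _] [sI lI]; split=> //; exact: (fsubset_trans sI sU). Qed.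

(* The only obstruction to [A `|` L] being a horizontal strip. *)
Definition touch L (A : tiling) : Prop := exists S x y, [/\ S \in A, x \in S,
  content x = pos n S + n%:Z - 1, y \in area L & y.2 = x.2 /\ x.1 = y.1.+1].

Lemma touch_sub L (A B : tiling) : A `<=` B -> touch L A -> touch L B.
Proof.
move=> sAB [S [x [y [SA h1 h2 h3 h4]]]]; exists S, x, y; split=> //.
exact: (fsubsetP sAB).
Qed.

Lemma strip_union D L T : strip n D L -> strip n (D `|` area L) T ->
  ~ touch L T -> strip n D (T `|` L).
Proof.
move=> sL sT ntouch.
have newT x : x \in area T -> x \in D `|` area L -> False.
  by move=> xT xDL; exact: (strip_new sT xDL xT).
split; first exact: (strip_base sL).
- by rewrite areaU fsetUC -fsetUA fsetUC (fsetUC _ D); exact: (strip_lower sT).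
- move=> x xD; rewrite areaU => /fsetUP[xT|]; last exact: (strip_new sL xD).
  by apply: (newT x xT); apply/fsetUP; left.
- by move=> S /fsetUP[]; [exact: (strip_ribbon sT)|exact: (strip_ribbon sL)].
- move=> S S' x /fsetUP[h|h] /fsetUP[h'|h'] xS xS'.
  + exact: (strip_disjoint sT h h' xS).
  + by case: (newT x (in_area h xS)); apply/fsetUP; right; exact: (in_area _ xS').
  + by case: (newT x (in_area h' xS')); apply/fsetUP; right; exact: (in_area _ xS).
  + exact: (strip_disjoint sL h h' xS).
move=> S x y /fsetUP[ST|SL] xS ex; rewrite areaU => /fsetUP[yT|yL] e2 e1.
- exact: (strip_north sT ST xS ex yT).
- by apply: ntouch; exists S, x, y.
(* A square of [T] just north of a head of [L] would already lie in the shape on which [T] is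
   placed, because that shape is lower. *)
- apply: (newT y yT); have low : lower (D `|` area L) := strip_base sT.
  by apply: (low y x); [apply/fsetUP; right; exact: (in_area _ xS)|rewrite e1|rewrite e2].
- exact: (strip_north sL SL xS ex yL).
Qed.

Lemma strip_untouched D L T : strip n D (T `|` L) -> ~ touch L T.
Proof.
move=> st [S [x [y [ST xS ex yL [e2 e1]]]]].
apply: (strip_north st _ xS ex _ e2 e1); first by apply/fsetUP; left.
by rewrite areaU; apply/fsetUP; right.
Qed.

(** Turns the conditions (1) and (2) on border strips, which speak of [hstrip], into statements
    about [touch]. *)
Lemma hstrip_union D L T : strip n D L -> strip n (D `|` area L) T ->
  hstrip n (T `|` L) <-> ~ touch L T.
Proof.
move=> sL sT; split=> [hs|nt]; last exact: (strip_hstrip (strip_union sL sT nt)).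
apply: (@strip_untouched D); apply: hstrip_strip => //; first exact: (strip_base sL).
  by rewrite areaU fsetUC -fsetUA fsetUC (fsetUC _ D); exact: (strip_lower sT).
move=> x xD; rewrite areaU => /fsetUP[xT|]; last exact: (strip_new sL xD).
by apply: (strip_new sT _ xT); apply/fsetUP; left.
Qed.

Record min_touch D L R M : Prop := MinTouch {
  mt_ideal : ideal D R M;
  mt_touch : touch L M;
  mt_min : forall I, I `<` M -> lower (D `|` area I) -> ~ touch L I
}.

Lemma touch_neq0 L M : touch L M -> M != fset0.
Proof. by move=> [S [_ [_ [SM _ _ _ _]]]]; apply/fset0Pn; exists S. Qed.

Lemma min_touch_exists D L R : strip n D R -> touch L R ->
  exists M, min_touch D L R M.
Proof.
move=> st tR.
suff main (R' : tiling) : ideal D R R' -> touch L R' -> exists M, min_touch D L R M.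
  by apply: (main R) => //; split=> //; exact: (strip_lower st).
move: {2}(#|` _|) (erefl #|` R'|) => m.
elim/ltn_ind: m R' => m IH R' em idR' tR'.
have [[I [sI lI tI]]|none] :=
  pselect (exists I, [/\ I `<` R', lower (D `|` area I) & touch L I]).
  apply: (IH _ _ I erefl) => //; first by rewrite -em; exact: fproper_ltn_card.
  by split=> //; exact: (fsubset_trans (fproper_sub sI) (proj1 idR')).
exists R'; split=> // I sI lI tI; apply: none; by exists I.
Qed.

(** The component of [M] containing a touching ribbon can itself be added first and touches [L]; by
    minimality it is all of [M]. *)
Lemma min_touch_block D L R M : strip n D R -> min_touch D L R M ->
  is_block M M.
Proof.
move=> st [idM tM minM]; have stM := strip_ideal st idM.
have [S [x [y [SM h1 h2 h3 h4]]]] := tM.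
have [B bB SB] := block_cover stM SM.
suff <- : B = M by split; [|exact: (block_neq0 bB)|split|exact: (block_connected bB)].
apply/eqP/negPn/negP => neq.
have prop : B `<` M by rewrite fproperEneq neq (block_sub bB).
apply: (minM _ prop); first exact: (proj2 (block_ideal stM bB)).
by exists S, x, y.
Qed.

Lemma min_touch_eq D L R M M' : min_touch D L R M -> min_touch D L R M' ->
  M `<=` M' -> M = M'.
Proof.
move=> [[_ lM] tM _] [_ _ min] s; apply/eqP/negPn/negP => neq.
by apply: (min M) => //; rewrite fproperEneq neq.
Qed.

(** If the two met or were adjacent, their union would be connected, hence they would be nested, and
    minimality would make them equal. *)
Lemma min_touch_far D L R M M' x y : strip n D R ->
  min_touch D L R M -> min_touch D L R M' -> M <> M' ->
  x \in area M -> y \in area M' -> (x == y) || adjacent x y -> False.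
Proof.
move=> st mM mM' neq xM yM' adj.
have [|s|s] := connected_ideals_nested n_gt0 st (mt_ideal mM) (mt_ideal mM') _.
- rewrite areaU; apply: connectedU.
  + exact: (block_connected (min_touch_block st mM)).
  + exact: (block_connected (min_touch_block st mM')).
  by exists x, y.
- exact: (neq (min_touch_eq mM mM' s)).
- by apply: neq; rewrite (min_touch_eq mM' mM s).
Qed.

Lemma min_touch_disjoint D L R M M' S : strip n D R ->
  min_touch D L R M -> min_touch D L R M' -> M <> M' ->
  S \in M -> S \in M' -> False.
Proof.
move=> st mM mM' neq SM SM'.
have SR := fsubsetP (proj1 (mt_ideal mM)) _ SM.
have /fset0Pn[x xS] := ribbon_neq0 n_gt0 (strip_ribbon st SR).
by apply: (min_touch_far (x := x) (y := x) st mM mM' neq (in_area SM xS) (in_area SM' xS));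
  rewrite eqxx.
Qed.

Definition good D L R U :=
  ideal D R U /\ forall B, is_block U B -> min_touch D L R B.

Lemma good0 D L R : strip n D R -> good D L R fset0.
Proof.
move=> st; split; first by split; rewrite ?fsub0set // area0 fsetU0; exact: (strip_base st).
by move=> B [sB B0 _ _]; case/negP: B0; rewrite -fsubset0.
Qed.

Lemma good_block D L R U M : strip n D R -> good D L R U ->
  min_touch D L R M -> (exists2 S, S \in M & S \in U) -> is_block U M.
Proof.
move=> st [idU gU] mM [S SM SU].
have [B bB SB] := block_cover (strip_ideal st idU) SU.
have [->//|/eqP neq] := eqVneq M B.
by case: (min_touch_disjoint st mM (gU _ bB) neq SM SB).
Qed.

(** [M] is far from every block of [U], so the blocks of the union are those of [U] together with
    [M]. *)
Lemma good_insert D L R U M : strip n D R -> good D L R U ->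
  min_touch D L R M -> ~~ (M `<=` U) ->
  [/\ good D L R (U `|` M), (U `|` M) `\` M = U &
      #|` blocks (U `|` M)| = #|` blocks U|.+1].
Proof.
move=> st gU mM MU; have [idU bU] := gU.
have dis S : S \in M -> S \in U -> False.
  move=> SM SU; case/negP: MU.
  by apply: (block_sub (good_block st gU mM _)); exists S.
have stU := strip_ideal st idU.
have idUM := idealU idU (mt_ideal mM); have stUM := strip_ideal st idUM.
have far x y : x \in area M -> y \in area U -> (x == y) || adjacent x y -> False.
  move=> xM /in_areaP[S SU yS] adj.
  have [B bB SB] := block_cover stU SU.
  apply: (min_touch_far st mM (bU _ bB) _ xM (in_area SB yS) adj) => e.
  by apply: (dis S) => //; rewrite e.
have sUM : closed_in (area (U `|` M)) (area U).
  split; first exact: (area_sub (fsubsetUl U M)).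
  move=> x y xU; rewrite areaU => /fsetUP[//|yM] adj.
  by case: (far y x yM xU); rewrite adjacent_sym adj orbT.
have sMU : closed_in (area (U `|` M)) (area M).
  split; first exact: (area_sub (fsubsetUr U M)).
  move=> x y xM; rewrite areaU => /fsetUP[yU|//] adj.
  by case: (far x y xM yU); rewrite adj orbT.
have bM := min_touch_block st mM.
have blk B : is_block (U `|` M) B <-> is_block U B \/ B = M.
  split=> [bB|[[sB B0 [sAB clB] cB]|->]].
  - have [S SB] := fset0Pn _ (block_neq0 bB).
    have /fsetUP[SU|SM] := fsubsetP (block_sub bB) _ SB.
      left; have [B' bB' SB'] := block_cover stU SU.
      suff -> : B = B' by [].
      apply: (block_eq stUM bB); last by exists S.
      case: bB' => [sB' B'0 [sAB' clB'] cB']; split=> //.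
        exact: (fsubset_trans sB' (fsubsetUl U M)).
      split; first exact: (fsubset_trans sAB' (proj1 sUM)).
      move=> x y xB' yUM adj; apply: (clB' x) => //.
      by apply: (proj2 sUM x) => //; exact: (fsubsetP sAB').
    right; apply: (block_eq stUM bB); last by exists S.
    by case: bM => [_ M0 _ cM]; split=> //; exact: fsubsetUr.
  - split=> //; first exact: (fsubset_trans sB (fsubsetUl U M)).
    split; first exact: (fsubset_trans sAB (proj1 sUM)).
    move=> x y xB yUM adj; apply: (clB x) => //.
    by apply: (proj2 sUM x) => //; exact: (fsubsetP sAB).
  - by case: bM => [_ M0 _ cM]; split=> //; exact: fsubsetUr.
split.
- by split=> // B /blk[/bU//|->].
- apply/fsetP => S; rewrite !inE; case SM : (S \in M) => /=; last by rewrite orbF.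
  by symmetry; apply/negP; exact: dis.
have -> : blocks (U `|` M) = M |` blocks U.
  apply/fsetP => B; rewrite in_fset1U; apply/idP/orP => [/(blocksP _ stUM)/blk[bB|->]|[/eqP ->|bB]].
  - by right; apply/(blocksP _ stU).
  - by left.
  - by apply/(blocksP _ stUM)/blk; right.
  - by apply/(blocksP _ stUM)/blk; left; apply/(blocksP _ stU).
rewrite cardfsU1; suff -> : M \notin blocks U by [].
by apply: contra MU => /(blocksP _ stU)/block_sub.
Qed.

(** [M] is a whole block of [U], so what remains is a union of blocks of [U]; the count follows by
    inserting [M] again. *)
Lemma good_remove D L R U M : strip n D R -> good D L R U ->
  min_touch D L R M -> M `<=` U ->
  [/\ good D L R (U `\` M), ~~ (M `<=` U `\` M), (U `\` M) `|` M = U &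
      #|` blocks U| = #|` blocks (U `\` M)|.+1].
Proof.
move=> st gU mM sMU.
have M0 := touch_neq0 (mt_touch mM); have [S SM] := fset0Pn _ M0.
have stU := strip_ideal st (proj1 gU).
have bM : is_block U M.
  by apply: (good_block st gU mM); exists S => //; exact: (fsubsetP sMU).
have aD : area (U `\` M) = area U `\` area M.
  apply/fsetP => x; apply/in_areaP/fsetDP => [[Q /fsetDP[QU QM] xQ]|[/in_areaP[Q QU xQ] xM]].
    split; first exact: (in_area _ xQ).
    by apply: contra QM; exact: (area_mem stU sMU QU xQ).
  exists Q => //; apply/fsetDP; split=> //; apply: contra xM => QM; exact: (in_area _ xQ).
have clD : closed_in (area U) (area (U `\` M)).
  by rewrite aD; exact: (closed_inD (block_closed bM)).
have idUD := closed_ideal stU (fsubsetDl U M) clD.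
have stUD := strip_ideal stU idUD.
have notin : ~~ (M `<=` U `\` M).
  by apply/negP => /fsubsetP/(_ _ SM); rewrite !inE SM.
have eU : (U `\` M) `|` M = U by rewrite fsetUC; exact: fsetUDl_sub.
have gD : good D L R (U `\` M).
  split; first exact: (ideal_trans (proj1 gU) idUD).
  move=> B [sB B0 [sAB clB] cB]; apply: (proj2 gU); split=> //.
    exact: (fsubset_trans sB (fsubsetDl U M)).
  split; first exact: (fsubset_trans sAB (proj1 clD)).
  move=> x y xB yU adj; apply: (clB x) => //.
  by apply: (proj2 clD x) => //; exact: (fsubsetP sAB).
split=> //.
by have [_ _] := good_insert st gD mM notin; rewrite eU.
Qed.

End Blocks.

(** * Border ribbon strips *)

Section Chains.

Local Open Scope fset_scope.
Local Open Scope ring_scope.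

Implicit Types (A C D E S : {fset square}) (x y z : square).
Implicit Types (T I J K L M B U R H : tiling) (r s t : seq tiling).

Variables (n : nat) (n_gt0 : (0 < n)%N).

Record conn_ideal D H L : Prop := ConnIdeal {
  ci_ideal : ideal D H L;
  ci_neq0 : L != fset0;
  ci_connected : edge_connected (area L)
}.

Lemma conn_ideal_top D H L : strip n D H -> conn_ideal D H L ->
  exists2 S, S \in L & forall S', S' \in L -> pos n S' <= pos n S.
Proof.
move=> st [_ L0 _].
have [S SL h] := fset_minarg (fun S => - pos n S) L0.
by exists S => // S' /h; rewrite lerN2.
Qed.

(** A connected ideal is determined by its last ribbon: two of them sharing [S] are nested, and in
    the larger one every ribbon before [S] is forced into the smaller. *)
Lemma conn_ideal_eq D H L L' S : strip n D H -> conn_ideal D H L ->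
  conn_ideal D H L' -> S \in L -> S \in L' ->
  (forall S', S' \in L -> pos n S' <= pos n S) ->
  (forall S', S' \in L' -> pos n S' <= pos n S) -> L = L'.
Proof.
have half L1 L2 : strip n D H -> conn_ideal D H L1 -> conn_ideal D H L2 ->
    S \in L1 -> S \in L2 -> (forall S', S' \in L2 -> pos n S' <= pos n S) ->
    L1 `<=` L2 -> L1 = L2.
  move=> st [id1 _ _] [id2 _ c2] S1 S2 top2 s12.
  apply/eqP; rewrite eqEfsubset s12 /=; apply/fsubsetP => Q Q2.
  have stL2 := strip_ideal st id2.
  have id12 : ideal D L2 L1 by split=> //; exact: (proj2 id1).
  have := top2 _ Q2; rewrite le_eqVlt => /orP[/eqP e|lt].
    by rewrite (pos_inj stL2 Q2 S2 n_gt0 e).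
  exact: (strip_ideal_pos n_gt0 stL2 c2 id12 Q2 S1 lt).
move=> st c1 c2 S1 S2 top1 top2.
have [|s|s] := connected_ideals_nested n_gt0 st (ci_ideal c1) (ci_ideal c2) _.
- rewrite areaU; apply: connectedU (ci_connected c1) (ci_connected c2) _.
  have /fset0Pn[x xS] := ribbon_neq0 n_gt0
    (strip_ribbon st (fsubsetP (proj1 (ci_ideal c1)) _ S1)).
  by exists x, x; rewrite eqxx (in_area S1 xS) (in_area S2 xS).
- exact: half s.
- by symmetry; apply: half s.
Qed.

(** A ribbon [S] corresponds to the block containing it in the ideal of all ribbons up to the
    position of [S]; conversely, a connected ideal yields its last ribbon. *)
Lemma card_conn_ideals D H : strip n D H ->
  exists2 F : {fset tiling}, (forall L, L \in F <-> conn_ideal D H L) &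
    #|` F| = #|` H|.
Proof.
move=> st.
pose P S L := [/\ conn_ideal D H L, S \in L &
  forall S', S' \in L -> pos n S' <= pos n S].
have exP S : S \in H -> exists L, P S L.
  move=> SH; pose J := [fset S' in H | pos n S' <= pos n S].
  have idJ : ideal D H J := pos_ideal _ st.
  have stJ := strip_ideal st idJ.
  have SJ : S \in J by rewrite !inE SH lexx.
  have [B bB SB] := block_cover n_gt0 stJ SJ.
  exists B; split=> //.
    split; [exact: (ideal_trans idJ (block_ideal stJ bB))|exact: (block_neq0 bB)|].
    exact: (block_connected bB).
  by move=> S' /(fsubsetP (block_sub bB)); rewrite !inE => /andP[].
pose f S := xget fset0 [set L | P S L]%classic.
have fP S : S \in H -> P S (f S) by move=> /exP[L PL]; exact: (xgetI fset0 PL).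
exists [fset f S | S in H].
  move=> L; split=> [/imfsetP[S /= /fP[c _ _] ->] //|cL].
  have [S SL top] := conn_ideal_top st cL.
  have SH := fsubsetP (proj1 (ci_ideal cL)) _ SL.
  apply/imfsetP; exists S => //=; have [cf Sf topf] := fP _ SH.
  exact: (conn_ideal_eq st cL cf SL Sf top topf).
apply: card_in_imfset => S S' /= SH S'H e.
have [cf Sf topf] := fP _ SH; have [cf' Sf' topf'] := fP _ S'H.
rewrite -e in Sf' topf'.
apply: (pos_inj st SH S'H n_gt0); apply/eqP.
by rewrite eq_le topf // topf'.
Qed.

Lemma areas_cons U r : areas (U :: r) = area U `|` areas r.
Proof. by rewrite /areas big_cons. Qed.

Lemma areas_nil : areas [::] = fset0.
Proof. by rewrite /areas big_nil. Qed.

Lemma areas_rev r : areas (rev r) = areas r.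
Proof. by rewrite /areas; apply: perm_big; rewrite perm_rev. Qed.

Lemma areas_rcons r U : areas (rcons r U) = areas r `|` area U.
Proof. by rewrite -areas_rev rev_rcons areas_cons areas_rev fsetUC. Qed.

(* Conditions (1) and (2) on the components of the strip [U] added after [L];
   [D] is the shape to which [U] is added. *)
Definition attached D L U := forall B, is_block U B ->
  touch n L B /\ forall I, I `<` B -> lower (D `|` area I) -> ~ touch n L I.

(* Border ribbon strips inside out: the head of the list is the last strip. *)
Fixpoint chain D r : Prop :=
  if r is U :: r' then
    if r' is L :: _ then
      [/\ chain D r', U != fset0, strip n (D `|` areas r') U &
          attached (D `|` areas r') L U]
    else [/\ U != fset0, strip n D U & edge_connected (area U)]
  else False.

Lemma chain_cons2 D U L r : chain D (U :: L :: r) =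
  [/\ chain D (L :: r), U != fset0, strip n (D `|` areas (L :: r)) U &
      attached (D `|` areas (L :: r)) L U].
Proof. by []. Qed.

Lemma chain_lower D r : chain D r -> lower (D `|` areas r).
Proof.
case: r => [//|U [|L r]] /=.
  by move=> [_ st _]; rewrite areas_cons areas_nil fsetU0; exact: (strip_lower st).
move=> [_ _ st _]; rewrite areas_cons (fsetUC (area U)) fsetUA.
exact: (strip_lower st).
Qed.

Lemma chain_new D r x : chain D r -> x \in D -> x \in areas r -> False.
Proof.
elim: r => [//|U [|L r] IH] /=.
  by move=> [_ st _] xD; rewrite areas_cons areas_nil fsetU0; exact: (strip_new st).
move=> [ch _ st _] xD; rewrite areas_cons => /fsetUP[xU|]; last exact: IH.
by apply: (strip_new st _ xU); apply/fsetUP; left.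
Qed.

(** Each block of a new strip touches the strip before it, which supplies an edge from the block
    into the area built so far. *)
Lemma chain_connected D r : chain D r -> edge_connected (areas r).
Proof.
elim: r => [//|U [|L r] IH].
  by move=> [_ _ cU]; rewrite areas_cons areas_nil fsetU0.
move=> [ch U0 st att]; have cL := IH ch; rewrite areas_cons.
set A := areas (L :: r) in st att cL *.
apply/edge_connectedP => E [sE clE].
have clX X : X `<=` area U `|` A -> closed_in X (E `&` X).
  move=> sX; split; first exact: fsubsetIr.
  move=> u v /fsetIP[uE uX] vX auv; apply/fsetIP; split=> //.
  by apply: (clE u) => //; exact: (fsubsetP sX).
have link B : is_block U B -> exists x y : square,
    [/\ x \in area B, y \in A & adjacent x y].
  move=> /att[[S [x [y [SB xS _ yL [e2 e1]]]]] _]; exists x, y; split.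
  - exact: (in_area SB xS).
  - by rewrite /A areas_cons; apply/fsetUP; left.
  - by rewrite /adjacent e2 e1 !eqxx /= orbT.
have sBU B : is_block U B -> area B `<=` area U `|` A.
  by move=> bB; apply: (fsubset_trans (proj1 (block_closed bB))); exact: fsubsetUl.
have [eA|eA] := proj1 (edge_connectedP A) cL _ (clX _ (fsubsetUr (area U) A)).
  left; apply/fsetP => x; rewrite inE; apply/negP => xE.
  have /fsetUP[xU|xA] := fsubsetP sE _ xE; last first.
    by have : x \in E `&` A; [apply/fsetIP | rewrite eA inE].
  have /in_areaP[S SU xS] := xU.
  have [B bB SB] := block_cover n_gt0 st SU.
  have [eB|eB] := proj1 (edge_connectedP _) (block_connected bB) _ (clX _ (sBU _ bB)).
    by have : x \in E `&` area B; [apply/fsetIP; rewrite (in_area SB xS) | rewrite eB inE].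
  have [u [v [uB vA auv]]] := link _ bB.
  have uE : u \in E by move: uB; rewrite -eB => /fsetIP[].
  have : v \in E `&` A.
    by apply/fsetIP; split=> //; apply: (clE u) => //; apply/fsetUP; right.
  by rewrite eA inE.
have AE y : y \in A -> y \in E by rewrite -eA => /fsetIP[].
right; apply/eqP; rewrite eqEfsubset sE /=; apply/fsubsetP => x /fsetUP[xU|/AE//].
have /in_areaP[S SU xS] := xU.
have [B bB SB] := block_cover n_gt0 st SU.
have [u [v [uB vA auv]]] := link _ bB.
have uE : u \in E.
  apply: (clE v); rewrite ?(adjacent_sym v) ?AE //.
  by apply: (fsubsetP (sBU _ bB)).
have [eB|eB] := proj1 (edge_connectedP _) (block_connected bB) _ (clX _ (sBU _ bB)).
  by have : u \in E `&` area B; [apply/fsetIP | rewrite eB inE].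
by have := in_area SB xS; rewrite -eB => /fsetIP[].
Qed.

(** Blocks stand for components, and [hstrip_union] translates both conditions. An addable set of
    ribbons of [U] is again a strip, which supplies the hypothesis [hstrip n I]. *)
Lemma attachedP D L U : strip n D L -> strip n (D `|` area L) U ->
  attached (D `|` area L) L U <->
  forall C, C \in components (area U) ->
    ~ hstrip n (ribbons_in U C `|` L) /\
    forall I, I `<` ribbons_in U C -> hstrip n I ->
      lower (D `|` area L `|` area I) -> hstrip n (I `|` L).
Proof.
move=> sL sU.
have blk B : is_block U B <-> exists2 C, C \in components (area U) & B = ribbons_in U C.
  rewrite -(blocksP n_gt0 _ sU); split=> [/imfsetP[C /= h ->]|[C h ->]]; first by exists C.
  by apply/imfsetP; exists C.
have sub I B : is_block U B -> I `<=` B -> lower (D `|` area L `|` area I) ->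
    strip n (D `|` area L) I.
  move=> bB sIB; apply: (strip_sub sU); exact: (fsubset_trans sIB (block_sub bB)).
split=> [att C CU|att B bB].
  have bC : is_block U (ribbons_in U C) by apply/blk; exists C.
  have [tC minC] := att _ bC.
  split=> [|I pI _ lI].
    move=> /(hstrip_union sL (strip_ideal sU (block_ideal sU bC))); exact.
  apply/(hstrip_union sL (sub _ _ bC (fproper_sub pI) lI)); exact: minC.
have /blk[C CU eB] := bB; subst B; have [h1 h2] := att _ CU.
split=> [|I pI lI].
  apply: contrapT => nt; apply: h1.
  by apply/(hstrip_union sL (strip_ideal sU (block_ideal sU bB))).
have sI := sub _ _ bB (fproper_sub pI) lI.
apply/(hstrip_union sL sI); apply: h2 => //; exact: (strip_hstrip sI).
Qed.

Lemma skew_shapeP la D : (exists nu, contained la nu /\ D = skew_shape nu la) <->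
  lower (diagram la `|` D) /\ (forall x, x \in diagram la -> x \in D -> False).
Proof.
split=> [[nu [lanu ->]]|[low new]].
  split; last by move=> x xla /fsetDP[_ /negP].
  by rewrite /skew_shape fsetUDl_sub //; exact: diagram_lower.
have [nu enu] := lower_diagram low.
exists nu; split; first by rewrite /contained enu fsubsetUl.
by rewrite /skew_shape enu fsetU_disjointDl.
Qed.

(* The clauses of [border_strip] that do not mention the outer shape. *)
Record pre_border (la : intpart) t : Prop := PreBorder {
  pb_nonnil : (0 < size t)%N;
  pb_nonempty : forall i, (i < size t)%N -> nth fset0 t i != fset0;
  pb_hstrip : forall i, (i < size t)%N -> hstrip n (nth fset0 t i);
  pb_disjoint : forall i j, (i < j < size t)%N ->
    [disjoint area (nth fset0 t i) & area (nth fset0 t j)];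
  pb_prefix : forall i, (i <= size t)%N ->
    exists nu, contained la nu /\ areas (take i t) = skew_shape nu la;
  pb_first : edge_connected (area (nth fset0 t 0));
  pb_attached : forall i, (0 < i < size t)%N ->
    forall C, C \in components (area (nth fset0 t i)) ->
    ~ hstrip n (ribbons_in (nth fset0 t i) C `|` nth fset0 t i.-1) /\
    forall I, I `<` ribbons_in (nth fset0 t i) C -> hstrip n I ->
      lower (diagram la `|` areas (take i t) `|` area I) ->
      hstrip n (I `|` nth fset0 t i.-1)
}.

Lemma in_areas x t i : (i < size t)%N -> x \in area (nth fset0 t i) ->
  x \in areas t.
Proof.
move=> lt xi; apply/bigfcupP; exists (nth fset0 t i) => //.
by rewrite mem_nth.
Qed.

Lemma pre_border_strip la t U : pre_border la (rcons t U) ->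
  strip n (diagram la `|` areas t) U.
Proof.
move=> pb; have szU : (size t < size (rcons t U))%N by rewrite size_rcons.
have nthU : nth fset0 (rcons t U) (size t) = U by rewrite nth_rcons ltnn eqxx.
have /skew_shapeP[low1 _] := pb_prefix pb (ltnW szU).
have := pb_prefix pb (leqnn _) => /skew_shapeP[].
rewrite take_size areas_rcons => low2 new2.
move: low1; rewrite -cats1 takel_cat // take_size => low1.
apply: hstrip_strip => //; first by rewrite -fsetUA.
- move=> x xDt xU; move: xDt => /fsetUP[xla|/bigfcupP[L]].
    by apply: (new2 x xla); apply/fsetUP; right.
  rewrite andbT => /(nthP fset0)[i lt eL] xL.
  have := pb_disjoint pb (i := i) (j := size t).
  rewrite nthU nth_rcons lt eL szU => /(_ isT)/fdisjointP/(_ _ xL)/negP; exact.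
- by have := pb_hstrip pb szU; rewrite nthU.
Qed.

Lemma pre_border_rcons la t U : (0 < size t)%N ->
  pre_border la (rcons t U) -> pre_border la t.
Proof.
move=> t0 pb.
have le_sz i : (i < size t)%N -> (i < size (rcons t U))%N.
  by rewrite size_rcons; lia.
have nthE i : (i < size t)%N -> nth fset0 (rcons t U) i = nth fset0 t i.
  by rewrite nth_rcons => ->.
have takeE i : (i <= size t)%N -> take i (rcons t U) = take i t.
  by move=> le; rewrite -cats1 takel_cat.
split=> //.
- by move=> i lt; rewrite -nthE //; exact: (pb_nonempty pb (le_sz _ lt)).
- by move=> i lt; rewrite -nthE //; exact: (pb_hstrip pb (le_sz _ lt)).
- move=> i j /andP[lij lt]; rewrite -!nthE ?(ltn_trans lij lt) //.
  by apply: (pb_disjoint pb); rewrite lij le_sz.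
- move=> i le; rewrite -takeE //; apply: (pb_prefix pb).
  by rewrite size_rcons leqW.
- by rewrite -nthE //; exact: (pb_first pb).
move=> i /andP[i0 lt]; have := pb_attached pb (i := i).
by rewrite i0 le_sz // !nthE ?takeE ?(ltnW lt) //; [exact|lia].
Qed.

(** By induction on the last strip. In a chain, disjointness and the skew prefixes are both
    expressed by placing each strip on the shape below it. *)
Lemma pre_border_chain la t : pre_border la t <-> chain (diagram la) (rev t).
Proof.
elim/last_ind: t => [|t U IH]; first by split=> // -[].
have szU : (size t < size (rcons t U))%N by rewrite size_rcons.
have nthU : nth fset0 (rcons t U) (size t) = U by rewrite nth_rcons ltnn eqxx.
have takeE i : (i <= size t)%N -> take i (rcons t U) = take i t.
  by move=> le; rewrite -cats1 takel_cat.
have nthE i : (i < size t)%N -> nth fset0 (rcons t U) i = nth fset0 t i.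
  by rewrite nth_rcons => ->.
have pre_prefix i : pre_border la t -> strip n (diagram la `|` areas t) U ->
    (i <= size (rcons t U))%N ->
    exists nu, contained la nu /\ areas (take i (rcons t U)) = skew_shape nu la.
  move=> pb st; rewrite size_rcons leq_eqVlt ltnS => /orP[/eqP ->|le]; last first.
    by rewrite takeE //; exact: (pb_prefix pb).
  rewrite -(size_rcons t U) take_size; apply/skew_shapeP; rewrite areas_rcons; split.
    by rewrite fsetUA; exact: (strip_lower st).
  move=> x xla /fsetUP[xt|xU]; last first.
    by apply: (strip_new st _ xU); apply/fsetUP; left.
  by have /skew_shapeP[_] := pb_prefix pb (leqnn _); rewrite take_size => /(_ x xla xt).
have [t0|t_gt0] := posnP (size t).
  have et : t = [::] by apply: size0nil.
  subst t; have -> : rev (rcons [::] U) = [:: U] by []; rewrite /=; split=> [pb|[U0 st cU]].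
    split; [exact: (pb_nonempty pb szU)| |exact: (pb_first pb)].
    by have := pre_border_strip (t := [::]) pb; rewrite areas_nil fsetU0.
  split=> //.
  - by case=> // _; exact: U0.
  - by case=> // _; exact: (strip_hstrip st).
  - by move=> i j /=; lia.
  - move=> i le; apply/skew_shapeP; case: i le => [|i] le.
      rewrite take0 areas_nil fsetU0; split; first exact: diagram_lower.
      by move=> x _; rewrite inE.
    rewrite take_oversize // areas_cons areas_nil fsetU0.
    by split; [exact: (strip_lower st)|exact: (strip_new st)].
  - by move=> i /=; lia.
case/lastP: t => [//|s L] in IH szU nthU takeE nthE pre_prefix t_gt0 *.
rewrite rev_rcons rev_rcons chain_cons2 -rev_rcons areas_rev.
have nthL : nth fset0 (rcons (rcons s L) U) (size s) = L.
  by rewrite nthE ?size_rcons // nth_rcons ltnn eqxx.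
have ei : (size (rcons s L)).-1 = size s by rewrite size_rcons.
have att_iff : pre_border la (rcons s L) -> strip n (diagram la `|` areas (rcons s L)) U ->
    (attached (diagram la `|` areas (rcons s L)) L U <->
     forall C, C \in components (area U) -> ~ hstrip n (ribbons_in U C `|` L) /\
       forall I, I `<` ribbons_in U C -> hstrip n I ->
       lower (diagram la `|` areas (rcons s L) `|` area I) -> hstrip n (I `|` L)).
  move=> pb; rewrite areas_rcons fsetUA; apply: attachedP.
  exact: (pre_border_strip pb).
split=> [pb|[/IH pb U0 st att]].
  have pb' := pre_border_rcons t_gt0 pb; have st := pre_border_strip pb.
  split=> //; [exact/IH|by have := pb_nonempty pb szU; rewrite nthU|].
  apply/(att_iff pb' st); have := pb_attached pb (i := size (rcons s L)).
  rewrite nthU szU t_gt0 ei nthL takeE // take_size => /(_ isT) h C CU.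
  by have := h C CU.
have idx i : (i < size (rcons (rcons s L) U))%N ->
    (i < size (rcons s L))%N \/ i = size (rcons s L).
  by rewrite size_rcons; lia.
split; first by rewrite size_rcons.
- by move=> i /idx[lt|->]; rewrite ?nthU // nthE //; exact: (pb_nonempty pb).
- by move=> i /idx[lt|->]; rewrite ?nthU ?nthE //; [exact: (pb_hstrip pb)|exact: (strip_hstrip st)].
- move=> i j /andP[lij /idx[lt|ej]].
    by rewrite !nthE ?(ltn_trans lij lt) //; apply: (pb_disjoint pb); rewrite lij.
  subst j; rewrite nthU nthE //; apply/fdisjointP => x xi; apply/negP => xU.
  by apply: (strip_new st _ xU); apply/fsetUP; right; exact: (in_areas lij xi).
- by move=> i le; apply: pre_prefix.
- by rewrite nthE ?size_rcons //; exact: (pb_first pb).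
move=> i /andP[i0 /idx[lt|eii]].
  rewrite !nthE //; last by lia.
  by rewrite takeE ?(ltnW lt) //; apply: (pb_attached pb); rewrite i0.
subst i; rewrite nthU ei nthL takeE // take_size.
exact/att_iff.
Qed.

Lemma border_stripE mu la t : border_strip n mu la t <->
  chain (diagram la) (rev t) /\ diagram mu = diagram la `|` areas t.
Proof.
have skewU i : (exists nu, contained la nu /\ areas (take i t) = skew_shape nu la) ->
   forall I, (forall x, x \in diagram la -> x \in area I -> False) ->
   (exists nu, contained la nu /\ areas (take i t) `|` area I = skew_shape nu la) <->
   lower (diagram la `|` areas (take i t) `|` area I).
  move=> /skew_shapeP[_ newt] I newI; split=> [/skew_shapeP[]|low].
    by rewrite fsetUA.
  apply/skew_shapeP; rewrite fsetUA; split=> // x xla /fsetUP[]; [exact: newt|exact: newI].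
split=> [bs|[ch emu]].
  split; last by rewrite (border_area bs) /skew_shape fsetUDl_sub //; exact: (border_contained bs).
  apply/pre_border_chain; split.
  - exact: (border_nonnil bs).
  - exact: (border_nonempty bs).
  - exact: (border_hstrip bs).
  - exact: (border_disjoint bs).
  - exact: (border_prefix bs).
  - exact: (border_first bs).
  move=> i lti C CU; split; first exact: (border_attached bs lti CU).
  move=> I pI hI lI; apply: (border_minimal bs lti CU pI hI).
  apply/skewU => //; first by apply: (border_prefix bs); case/andP: lti => _ /ltnW.
  move=> x xla /(fsubsetP (area_sub (fproper_sub pI)))/in_areaP[S].
  rewrite !inE => /andP[SU _] xS.
  have /skew_shapeP[_ new] := border_prefix bs (leqnn (size t)).
  apply: (new x xla); rewrite take_size.
  by apply: (@in_areas _ _ i); [case/andP: lti|exact: (in_area SU xS)].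
have pb := proj2 (pre_border_chain la t) ch.
have e : areas t = skew_shape mu la.
  rewrite /skew_shape emu fsetU_disjointDl // => x xla xt.
  by apply: (chain_new ch xla); rewrite areas_rev.
split=> //.
- by rewrite /contained emu fsubsetUl.
- by rewrite -e -areas_rev; exact: (chain_connected ch).
- exact: (pb_nonnil pb).
- exact: (pb_nonempty pb).
- exact: (pb_hstrip pb).
- exact: (pb_disjoint pb).
- exact: (pb_prefix pb).
- exact: (pb_first pb).
- by move=> i lti C CU; have [] := pb_attached pb lti CU.
move=> i lti C CU I pI hI ex; have [_] := pb_attached pb lti CU; apply=> //.
apply/(skewU i) => //; first by apply: (pb_prefix pb); case/andP: lti => _ /ltnW.
by have /skew_shapeP[_ new] := ex; move=> x xla xI; apply: (new x xla); apply/fsetUP; right.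
Qed.

End Chains.

(** * The sign-reversing involution *)

Section SignReversing.

Local Open Scope classical_set_scope.
Local Open Scope ring_scope.

(** Reindexing by [tau] turns the sum into its own negative, and 2 is invertible. *)
Lemma fsbig_involution (F : fieldType) (T : choiceType) (A : set T) (f : T -> F)
    (tau : T -> T) : (2%:R : F) != 0 -> finite_set A ->
  (forall x, A x -> [/\ A (tau x), tau (tau x) = x & f (tau x) = - f x]) ->
  \sum_(x \in A) f x = 0.
Proof.
move=> two_neq0 finA tauP.
have e : \sum_(x \in A) f x = - \sum_(x \in A) f x.
  rewrite {1}(@reindex_fsbig _ _ _ _ _ tau A A).
    rewrite !(fsbig_finite _ _ finA) -sumrN; apply: eq_big_seq => x.
    by rewrite in_fset_set // inE => /tauP[].
  split.
  - by move=> x /tauP[].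
  - move=> x y; rewrite !inE => /tauP[_ ex _] /tauP[_ ey _] exy.
    by rewrite -ex exy ey.
  - by move=> x /tauP[Ax ex _]; exists (tau x).
move/eqP: e; rewrite -addr_eq0 -mulr2n -mulr_natl mulf_eq0 (negbTE two_neq0) /=.
by move/eqP.
Qed.

Lemma finite_bounded_seq (T : choiceType) (A : {fset T}) (N : nat) :
  finite_set [set r : seq T | (size r <= N)%N && all (mem A) r].
Proof.
elim: N => [|N IH].
  by apply: (sub_finite_set _ (finite_set1 [::])) => -[|? ?].
apply: (sub_finite_set _ (_ : finite_set ([set [::]] `|`
  [set a :: r | a in [set` A] & r in [set r | (size r <= N)%N && all (mem A) r]]))).
  by move=> [|a r] /=; [left|rewrite ltnS andbCA => /andP[aA h]; right; exists a => //; exists r].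
by rewrite finite_setU; split; [exact: finite_set1|exact: finite_image2].
Qed.

End SignReversing.

(** * Pairs of a border strip and a horizontal strip, and their cancellation *)

Section States.

Local Open Scope fset_scope.
Local Open Scope ring_scope.

Implicit Types (A C D E S : {fset square}) (x y z : square).
Implicit Types (T I J K L M B U R H : tiling) (r s : seq tiling).

Variables (n : nat) (n_gt0 : (0 < n)%N) (F : fieldType) (t : F).
Hypothesis two_neq0 : (2%:R : F) != 0.

Definition state : Type := (seq tiling * tiling)%type.

(** One more than the height of the border strip, with components counted as sets of ribbons. *)
Definition ht r := (\sum_(U <- r) #|` blocks U|)%N.

Definition weight (q : state) : F :=
  (-1) ^+ (ht q.1).-1 * t ^+ (border_spin q.1 + spin q.2).

Variables (D E : {fset square}) (k : nat).

Record is_state (q : state) : Prop := IsState {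
  state_chain : chain n D q.1;
  state_strip : strip n (D `|` areas q.1) q.2;
  state_area : D `|` areas q.1 `|` area q.2 = E;
  state_size : (border_size q.1 + #|` q.2|)%N = k
}.

Definition fixed (q : state) : Prop :=
  size q.1 = 1 /\ ~ touch n (head fset0 q.1) q.2.

(* [(s, R, U)]: a chain [s], a strip [R] touching its last strip, and the part
   [U] of [R] which is about to be moved to the end of [s]. *)
Record is_group (g : seq tiling * tiling * tiling) : Prop := IsGroup {
  group_chain : chain n D g.1.1;
  group_strip : strip n (D `|` areas g.1.1) g.1.2;
  group_touch : touch n (head fset0 g.1.1) g.1.2;
  group_good : good n (D `|` areas g.1.1) (head fset0 g.1.1) g.1.2 g.2;
  group_area : D `|` areas g.1.1 `|` area g.1.2 = E;
  group_size : (border_size g.1.1 + #|` g.1.2|)%N = k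
}.

Definition of_group (g : seq tiling * tiling * tiling) : state :=
  if g.2 == fset0 then g.1 else (g.2 :: g.1.1, g.1.2 `\` g.2).

(** If the top strip touches the last strip of the chain, nothing has been split off it; otherwise
    the last strip is the part split off, and it is merged back. *)
Definition to_group (q : state) : seq tiling * tiling * tiling :=
  if `[< touch n (head fset0 q.1) q.2 >] then (q, fset0)
  else (behead q.1, q.2 `|` head fset0 q.1, head fset0 q.1).

Lemma border_size_cons U r : border_size (U :: r) = (#|` U| + border_size r)%N.
Proof. by rewrite /border_size big_cons. Qed.

Lemma border_spin_cons U r : border_spin (U :: r) = (spin U + border_spin r)%N.
Proof. by rewrite /border_spin big_cons. Qed.

Lemma ht_cons U r : ht (U :: r) = (#|` blocks U| + ht r)%N.
Proof. by rewrite /ht big_cons. Qed.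

Lemma spin_diff R U : U `<=` R -> (spin U + spin (R `\` U))%N = spin R.
Proof.
move=> /fsubsetP sUR; rewrite /spin [in RHS](big_fsetID _ (mem U)) /=.
congr addn; apply: eq_fbigl => S; rewrite !inE /=; last by rewrite andbC.
by case SU : (S \in U); rewrite ?andbF // sUR.
Qed.

Lemma card_diff R U : U `<=` R -> (#|` U| + #|` R `\` U|)%N = #|` R|.
Proof. by move=> sUR; rewrite cardfsDS // subnKC // fsubset_leq_card. Qed.

Lemma strip_disjoint_above D' L T S : strip n D' L ->
  strip n (D' `|` area L) T -> S \in L -> S \in T -> False.
Proof.
move=> sL sT SL ST.
have /fset0Pn[x xS] := ribbon_neq0 n_gt0 (strip_ribbon sL SL).
apply: (strip_new sT _ (in_area ST xS)).
by apply/fsetUP; right; exact: (in_area SL xS).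
Qed.

Lemma to_groupP q : is_state q -> ~ fixed q ->
  is_group (to_group q) /\ of_group (to_group q) = q.
Proof.
case: q => r T [/= ch st eE ek] nfix; rewrite /to_group /=.
case: asboolP => [tch|ntch].
  by split; [split=> //=; exact: good0|rewrite /of_group eqxx].
case: r => [//|U [|L s]] in ch st eE ek nfix ntch *; first by case: nfix.
have [chL U0 sU att] := ch.
have D'E : D `|` areas (L :: s) `|` area U = D `|` areas (U :: L :: s).
  by rewrite (areas_cons U) (fsetUC (area U)) fsetUA.
rewrite -D'E in st eE.
have dTU S : S \in U -> S \in T -> False := strip_disjoint_above sU st.
have sR := strip_union sU st ntch.
have sUR : U `<=` T `|` U := fsubsetUr T U.
rewrite /of_group /= (negbTE U0); split; last first.
  by rewrite fsetUC fsetU_disjointDl.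
split=> //=.
- have [S SU] := fset0Pn _ U0; have [B bB SB] := block_cover n_gt0 sU SU.
  apply: (touch_sub (fsubset_trans (block_sub bB) sUR)).
  exact: (proj1 (att _ bB)).
- split; first by split=> //; exact: (strip_lower sU).
  move=> B bB; have [tB minB] := att _ bB; split=> //.
  split; first exact: (fsubset_trans (block_sub bB) sUR).
  exact: (proj2 (block_ideal sU bB)).
- by rewrite areaU (fsetUC (area T)) fsetUA.
- rewrite -ek (border_size_cons U) -(card_diff sUR) fsetUC fsetU_disjointDl //.
  by rewrite addnA (addnC (border_size _)).
Qed.

Lemma of_groupP g : is_group g ->
  [/\ is_state (of_group g), ~ fixed (of_group g) & to_group (of_group g) = g].
Proof.
case: g => [[s R] U] [/= ch st tch gU eE ek]; rewrite /of_group /=.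
have [->|U0] := eqVneq U fset0.
  split=> //; first by move=> [].
  by rewrite /to_group /=; case: asboolP.
have [idU bU] := gU; have sUR := proj1 idU.
have sU := strip_ideal st idU; have sD := strip_diff st idU.
have eR : (R `\` U) `|` U = R by rewrite fsetUC fsetUDl_sub.
case: s => [//|L s] in ch st tch gU eE ek idU bU sU sD *.
have D'E : D `|` areas (U :: L :: s) = D `|` areas (L :: s) `|` area U.
  by rewrite (areas_cons U) (fsetUC (area U)) fsetUA.
(* Since [R] as a whole is a horizontal strip, its remainder cannot touch [U]; hence [to_group]
   takes its second branch and recovers [R]. *)
have nt : ~ touch n U (R `\` U).
  by apply: strip_untouched; rewrite eR; exact: st.
split.
- split; rewrite ?D'E //.
  + rewrite chain_cons2; split=> // B bB; have [_ tB minB] := bU _ bB; by split.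
  + by rewrite -fsetUA -areaU fsetUDl_sub.
  + by rewrite /= (border_size_cons U) -ek -(card_diff sUR) addnA (addnC #|` _|).
- by case.
- by rewrite /to_group /=; case: asboolP => //= _; rewrite eR.
Qed.

Definition toggle U M : tiling := if M `<=` U then U `\` M else U `|` M.

(** The choice depends on the shape, [L] and [R] but not on the part already split off, so toggling
    it twice restores the group. *)
Definition chosen D' L R : tiling :=
  xget fset0 [set M | min_touch n D' L R M]%classic.

Definition flip (g : seq tiling * tiling * tiling) :=
  (g.1, toggle g.2 (chosen (D `|` areas g.1.1) (head fset0 g.1.1) g.1.2)).

(** The sign has a truncated predecessor as exponent; positivity ensures that one block more or less
    really changes the sign. *)
Lemma chain_ht r : chain n D r -> (0 < ht r)%N.
Proof.
case: r => [//|U r] ch; rewrite ht_cons addn_gt0; apply/orP; left.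
have [D' [U0 sU]] : exists D', U != fset0 /\ strip n D' U.
  case: r ch => [|L r] [].
    by move=> U0 sU _; exists D.
  by move=> _ U0 sU _; exists (D `|` areas (L :: r)).
have [S SU] := fset0Pn _ U0; have [B bB SB] := block_cover n_gt0 sU SU.
by rewrite cardfs_gt0; apply/fset0Pn; exists B; apply/(blocksP n_gt0 _ sU).
Qed.

(** The tiling is only redistributed, so the spin is independent of the moved part, which enters
    through its number of blocks alone. *)
Lemma weight_of_group g : is_group g ->
  weight (of_group g) = (-1) ^+ (#|` blocks g.2| + ht g.1.1).-1 *
                        t ^+ (border_spin g.1.1 + spin g.1.2).
Proof.
case: g => [[s R] U] [/= ch st tch [idU bU] eE ek]; rewrite /of_group /weight /=.
have [->|U0] := eqVneq U fset0.
  suff -> : blocks fset0 = fset0 by rewrite cardfs0.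
  have s0 := strip_ideal st (proj1 (good0 (head fset0 s) st)).
  apply/fsetP => B; rewrite inE; apply/negP => /(blocksP n_gt0 _ s0)[sB B0 _ _].
  by case/negP: B0; rewrite -fsubset0.
rewrite (ht_cons U) (border_spin_cons U) /= -(spin_diff (proj1 idU)).
by rewrite addnA (addnC (spin U)).
Qed.

Lemma flipP g : is_group g -> [/\ is_group (flip g), flip (flip g) = g &
  weight (of_group (flip g)) = - weight (of_group g)].
Proof.
move=> gg; have [_ st tch gU _ _] := gg.
have h_gt0 := chain_ht (group_chain gg).
pose M := chosen (D `|` areas g.1.1) (head fset0 g.1.1) g.1.2.
have mM : min_touch n (D `|` areas g.1.1) (head fset0 g.1.1) g.1.2 M.
  by have [M0 mM0] := min_touch_exists st tch; exact: (xgetI fset0 mM0).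
have signE h h' : h' = h.+1 -> (0 < h)%N ->
    (-1) ^+ h'.-1 = - (-1) ^+ h.-1 :> F.
  by case: h => [//|h] ->; rewrite /= exprS mulN1r.
have ggf : good n (D `|` areas g.1.1) (head fset0 g.1.1) g.1.2 (flip g).2 ->
    is_group (flip g) by case: gg => *; split.
have [sMU|nsMU] := boolP (M `<=` g.2).
  have [gU' nM eU bU] := good_remove n_gt0 st gU mM sMU.
  have f2 : (flip g).2 = g.2 `\` M by rewrite /flip /toggle sMU.
  have gf : is_group (flip g) by apply: ggf; rewrite f2.
  split=> //.
    by rewrite {1}/flip f2 /toggle /= -/M (negbTE nM) eU; case: (g).
  rewrite !weight_of_group // f2 bU addSn -mulNr; congr (_ * _).
  by rewrite (signE _ _ erefl) ?opprK // addn_gt0 h_gt0 orbT.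
have [gU' eU bU] := good_insert n_gt0 st gU mM nsMU.
have f2 : (flip g).2 = g.2 `|` M by rewrite /flip /toggle (negbTE nsMU).
have gf : is_group (flip g) by apply: ggf; rewrite f2.
split=> //.
  by rewrite {1}/flip f2 /toggle /= -/M fsubsetUr eU; case: (g).
rewrite !weight_of_group // f2 bU addSn -mulNr; congr (_ * _).
by rewrite (signE _ _ erefl) // addn_gt0 h_gt0 orbT.
Qed.

Lemma chain_cards r : chain n D r -> (size r <= border_size r)%N.
Proof.
have pos U : U != fset0 -> (0 < #|` U|)%N by rewrite cardfs_gt0.
elim: r => [//|U [|L r] IH]; rewrite border_size_cons.
  by move=> [/pos U0 _ _]; rewrite /= ltn_addr.
move=> [/IH le /pos U0 _ _]; rewrite [size _]/= -addn1 addnC.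
exact: leq_add.
Qed.

(** Ribbons are subsets of [E], so only finitely many strips occur, and a chain of nonempty strips
    has at most [k] entries. *)
Lemma finite_state : finite_set [set q | is_state q]%classic.
Proof.
pose A := fpowerset (fpowerset E).
apply: (sub_finite_set _ (_ : finite_set ([set r | (size r <= k)%N && all (mem A) r]
  `*` [set` A])%classic)); last first.
  by apply: finite_setX; [exact: finite_bounded_seq|exact: finite_fset].
have inA T : area T `<=` E -> T \in A.
  move=> sT; rewrite fpowersetE; apply/fsubsetP => S ST; rewrite fpowersetE.
  by apply: (fsubset_trans _ sT); apply/fsubsetP => x; exact: (in_area ST).
move=> [r T] [/= ch st eE ek]; split=> /=; last first.
  by apply: inA; rewrite -eE fsubsetUr.
apply/andP; split.
  by rewrite -ek; apply: (leq_trans (chain_cards ch)); exact: leq_addr.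
apply/allP => U Ur; apply: inA; rewrite -eE; apply/fsubsetP => x xU.
apply/fsetUP; left; apply/fsetUP; right; apply/bigfcupP.
by exists U => //; rewrite Ur.
Qed.

Lemma nonfixed_sum :
  \sum_(q \in ([set q | is_state q] `&` ~` [set q | fixed q])%classic) weight q = 0.
Proof.
apply: (@fsbig_involution _ _ _ _ (fun q => of_group (flip (to_group q)))) => //.
  exact: (sub_finite_set (@subIsetl _ _ _) finite_state).
move=> q [sq nq]; have [gq eq] := to_groupP sq nq.
have [gf ff wf] := flipP gq; have [sf nf tf] := of_groupP gf.
by split; [split|rewrite tf ff|rewrite wf eq].
Qed.

(** The two strips of a fixed state unite to a horizontal strip, which is [H] by uniqueness of the
    tiling; the first of them can be any nonempty connected ideal of [H]. *)
Lemma fixed_sum H : strip n D H -> D `|` area H = E -> #|` H| = k ->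
  \sum_(q \in ([set q | is_state q] `&` [set q | fixed q])%classic) weight q =
  k%:R * t ^+ spin H.
Proof.
move=> sH eE ek; have [G GP cG] := card_conn_ideals n_gt0 sH.
rewrite (@reindex_fsbig _ _ _ _ _ (fun L => ([:: L], H `\` L)) [set` G]%classic).
  transitivity (\sum_(L \in [set` G]%classic) t ^+ spin H).
    apply: eq_fsbigr => L; rewrite inE /= => /GP[idL L0 cL].
    (* A connected ideal is a single block, so the height is 0 and the sign is positive. *)
    rewrite /weight /= ht_cons /border_spin /ht !big_cons !big_nil !addn0.
    rewrite (spin_diff (proj1 idL)); suff -> : blocks L = [fset L].
      by rewrite cardfs1 mul1r.
    have sL := strip_ideal sH idL.
    have bL : is_block L L by split.
    apply/fsetP => B; rewrite inE; apply/idP/eqP => [/(blocksP n_gt0 _ sL) bB|->].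
      have [S SB] := fset0Pn _ (block_neq0 bB).
      apply: (block_eq n_gt0 sL bB bL); exists S => //.
      exact: (fsubsetP (block_sub bB)).
    exact/(blocksP n_gt0 _ sL).
  rewrite -fsbig_seq ?fset_uniq // big_const_seq count_predT iter_addr_0.
  by rewrite cG ek mulr_natl.
split.
- move=> L /= /GP[idL L0 cL]; have sL := strip_ideal sH idL.
  have eL : H `\` L `|` L = H by rewrite fsetUC (fsetUDl_sub (proj1 idL)).
  split; last first.
    split=> //=; apply: (strip_untouched (D := D)); rewrite eL; exact: sH.
  split=> /=; rewrite ?areas_cons ?areas_nil ?fsetU0.
  + by split.
  + exact: (strip_diff sH idL).
  + by rewrite -fsetUA -areaU (fsetUDl_sub (proj1 idL)).
  + by rewrite /border_size big_cons big_nil addn0 (card_diff (proj1 idL)).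
- by move=> L L' _ _ [].
move=> [r T] [[/= ch st eE' ek'] [/= sz nt]].
case: r => [//|L [|//]] in ch st eE' ek' sz nt *.
rewrite areas_cons areas_nil fsetU0 /= in st eE' nt; case: ch => L0 sL cL.
have sU := strip_union sL st nt.
have eH : T `|` L = H.
  apply: (strip_unique n_gt0 sU sH).
  rewrite -(fsetU_disjointDl (strip_new sU)) -(fsetU_disjointDl (strip_new sH)).
  by rewrite eE -eE' areaU (fsetUC (area T)) fsetUA.
exists L => /=.
  apply/GP; split=> //; split; first by rewrite -eH fsubsetUr.
  exact: (strip_lower sL).
congr pair; rewrite -eH fsetUC fsetU_disjointDl // => S SL ST.
exact: (strip_disjoint_above sL st SL ST).
Qed.

Lemma fixed_none :
  ~ (exists H, [/\ strip n D H, D `|` area H = E & #|` H| = k]) ->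
  \sum_(q \in ([set q | is_state q] `&` [set q | fixed q])%classic) weight q = 0.
Proof.
move=> none; apply: fsbig1 => -[r T] [[/= ch st eE' ek'] [/= sz nt]].
case: none; case: r => [//|L [|//]] in ch st eE' ek' sz nt *.
rewrite areas_cons areas_nil fsetU0 /= in st eE' nt; case: ch => L0 sL cL.
exists (T `|` L); split; first exact: strip_union.
  by rewrite areaU (fsetUC (area T)) fsetUA.
rewrite -ek' /border_size big_cons big_nil addn0.
rewrite -(card_diff (fsubsetUr T L)) fsetUC fsetU_disjointDl // => S SL ST.
exact: (strip_disjoint_above sL st SL ST).
Qed.

Lemma state_sum :
  \sum_(q \in [set q | is_state q]%classic) weight q =
  \sum_(q \in ([set q | is_state q] `&` [set q | fixed q])%classic) weight q.
Proof.
by rewrite (fsbigID [set q | fixed q]%classic _ _ finite_state) nonfixed_sum /= addr0.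
Qed.

End States.

(** * Newton's identity for the coefficients *)

Section Newton.

Local Open Scope fset_scope.
Local Open Scope ring_scope.

Implicit Types (mu nu la : intpart) (T : tiling).

Variables (n : nat) (n_gt0 : (0 < n)%N).

Lemma strip0 (D : {fset square}) : lower D -> strip n D fset0.
Proof.
by move=> low; split; rewrite ?area0 ?fsetU0 // => x _; rewrite inE.
Qed.

Lemma hstrip_tilingE mu la T : hstrip_tiling n mu la T <->
  strip n (diagram la) T /\ diagram mu = diagram la `|` area T.
Proof.
split=> [[sub eT hT]|[st emu]].
  have emu : diagram mu = diagram la `|` area T.
    by rewrite eT /skew_shape fsetUDl_sub.
  split=> //; apply: hstrip_strip => //; first exact: diagram_lower.
    by rewrite -emu; exact: diagram_lower.
  by move=> x xla; rewrite eT => /fsetDP[_ /negP].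
split; [by rewrite /contained emu fsubsetUl| |exact: (strip_hstrip st)].
by rewrite /skew_shape emu (fsetU_disjointDl (strip_new st)).
Qed.

Lemma hstrip_tiling_unique mu la T T' :
  hstrip_tiling n mu la T -> hstrip_tiling n mu la T' -> T = T'.
Proof.
move=> /hstrip_tilingE[st e] /hstrip_tilingE[st' e'].
apply: (strip_unique n_gt0 st st').
by rewrite -(fsetU_disjointDl (strip_new st)) -e e' (fsetU_disjointDl (strip_new st')).
Qed.

Lemma hstrip_spinE mu la T : hstrip_tiling n mu la T ->
  hstrip_spin n mu la = spin T.
Proof.
move=> hT; congr spin; apply: (@hstrip_tiling_unique mu la) => //.
exact: (xgetI fset0 hT).
Qed.

Lemma hstrip_tiling0 la : hstrip_tiling n la la fset0.
Proof.
apply/hstrip_tilingE; rewrite area0 fsetU0; split=> //.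
exact: (strip0 (@diagram_lower la)).
Qed.

Variables (F : fieldType) (t : F).
Hypothesis two_neq0 : (2%:R : F) != 0.

Definition hcoef j mu la : F :=
  if `[< is_hstrip n j mu la >] then t ^+ hstrip_spin n mu la else 0.

Lemma hcoef_contained j mu la : hcoef j mu la != 0 -> contained la mu.
Proof.
rewrite /hcoef; case: asboolP => [|_]; last by rewrite eqxx.
by move=> [T [[sub _ _] _]].
Qed.

Lemma hcoef0 mu la : hcoef 0 mu la = (mu == la)%:R.
Proof.
rewrite /hcoef; case: asboolP => [[T [hT /cardfs0_eq T0]]|none].
  rewrite (hstrip_spinE hT); move: hT; rewrite T0 => /hstrip_tilingE[_].
  rewrite area0 fsetU0 => /diagram_inj ->.
  by rewrite /spin big_seq_fset0 expr0 eqxx.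
case: eqP => // e; case: none; exists fset0; rewrite e cardfs0; split=> //.
exact: hstrip_tiling0.
Qed.

Lemma border_height_rev la (r : seq tiling) : chain n (diagram la) (rev r) ->
  border_height r = (ht (rev r)).-1.
Proof.
suff main (s : seq tiling) : chain n (diagram la) s ->
    ht s = (\sum_(U <- s) #|` components (area U)|)%N.
  move=> /main ->; rewrite /border_height; congr _.-1.
  by apply: perm_big; rewrite perm_sym perm_rev.
elim: s => [//|U [|L s] IH].
  by move=> [_ st _]; rewrite /ht !big_cons !big_nil (card_blocks st).
by move=> [/IH e _ st _]; rewrite ht_cons e [RHS]big_cons (card_blocks st).
Qed.

(** Border strips embed into the states as those with an empty top strip. *)
Lemma finite_border_strips mu la k :
  finite_set [set T | border_strip n mu la T /\ border_size T = k]%classic.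
Proof.
pose f (T : seq tiling) : state := (rev T, fset0).
apply: (sub_finite_set _ (_ : finite_set (f @^-1`
    [set q | is_state n (diagram la) (diagram mu) k q]))%classic).
  move=> T /= [/border_stripE-/(_ n_gt0)[ch e] sz]; split=> /=.
  - exact: ch.
  - exact: (strip0 (chain_lower ch)).
  - by rewrite area0 fsetU0 areas_rev.
  - rewrite addn0 -sz /border_size; apply: perm_big.
    by rewrite perm_rev.
apply: finite_preimage; last exact: finite_state.
by move=> T T' _ _ [] /(can_inj revK).
Qed.

Definition split_at j nu la (q : state) : Prop :=
  diagram nu = diagram la `|` areas q.1 /\ #|` q.2| = j.

(** With the intermediate shape [nu] fixed, uniqueness leaves a single choice for the top strip, so
    the states are indexed by the border strips from [la] to [nu]. *)
Lemma hcoef_calX k j mu nu la : (j <= k)%N ->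
  hcoef j mu nu * calX n (k - j) nu la t =
  \sum_(q \in ([set q | is_state n (diagram la) (diagram mu) k q] `&`
               [set q | split_at j nu la q])%classic) weight t q.
Proof.
move=> lejk; rewrite /hcoef; case: asboolP => [[T0 [hT0 cT0]]|none]; last first.
  rewrite mul0r fsbig1 // => -[r T] [[/= _ st eE _] [/= enu cT]].
  case: none; exists T; split=> //; apply/hstrip_tilingE.
  by rewrite enu.
rewrite (hstrip_spinE hT0) /calX.
rewrite (fsbig_finite _ _ (finite_border_strips nu la (k - j))) mulr_sumr.
rewrite -(fsbig_finite _ _ (finite_border_strips nu la (k - j))).
have /hstrip_tilingE[st0 emu] := hT0.
rewrite [RHS](@reindex_fsbig _ _ _ _ _ (fun r : seq tiling => (rev r, T0))
  [set r | border_strip n nu la r /\ border_size r = (k - j)%N]%classic).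
  apply: eq_fsbigr => T; rewrite inE => -[/(border_stripE n_gt0)[ch _] _].
  rewrite /weight /= (border_height_rev ch) mulrCA -exprD addnC.
  congr (_ * t ^+ (_ + _)); rewrite /border_spin; apply: perm_big.
  by rewrite perm_sym perm_rev.
have sz (T : seq tiling) : border_size (rev T) = border_size T.
  by rewrite /border_size; apply: perm_big; rewrite perm_rev.
split.
- move=> T [/(border_stripE n_gt0)[ch enu] szT]; split; split=> //=.
  + by rewrite areas_rev -enu.
  + by rewrite areas_rev -enu.
  + by rewrite sz szT cT0 subnK.
  + by rewrite areas_rev.
- by move=> T T' _ _ [] /(can_inj revK).
move=> [r T] [[/= ch st eE ek] [/= enu cT]].
exists (rev r); last first.
  rewrite revK; congr pair; apply: (hstrip_tiling_unique hT0).
  by apply/hstrip_tilingE; rewrite enu.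
split; last by rewrite sz -ek cT addnK.
by apply/(border_stripE n_gt0); rewrite revK areas_rev.
Qed.

(* The identity [k h_k = sum_j h_j p_(k - j)], with [calX] in place of the power
   sums. *)
Lemma hcoef_newton k mu la (P : seq intpart) : uniq P ->
  (forall nu, contained nu mu -> nu \in P) ->
  k%:R * hcoef k mu la =
  \sum_(j < k) \sum_(nu <- P) hcoef j mu nu * calX n (k - j) nu la t.
Proof.
move=> uniqP memP.
pose st := [set q | is_state n (diagram la) (diagram mu) k q]%classic.
have fin_st : finite_set st := @finite_state n _ _ _.
transitivity (\sum_(q \in st) weight t q).
  rewrite (state_sum n_gt0 t two_neq0) /hcoef; case: asboolP => [[T [hT cT]]|none].
    have /hstrip_tilingE[sT emu] := hT.
    by rewrite (hstrip_spinE hT) -(fixed_sum n_gt0 t sT (esym emu) cT).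
  rewrite mulr0 fixed_none // => -[H [sH eH cH]]; apply: none; exists H; split=> //.
  by apply/hstrip_tilingE.
(* Each state is counted for exactly one pair: [nu] is the shape reached by its chain and [j] the
   size of its top strip. *)
transitivity (\sum_(j < k) \sum_(nu <- P) \sum_(q <- fset_set st)
    if `[< split_at j nu la q >] then weight t q else 0); last first.
  apply: eq_bigr => j _; apply: eq_bigr => nu _.
  rewrite hcoef_calX ?(ltnW (ltn_ord j)) // fsbig_mkcondr (fsbig_finite _ _ fin_st).
  by apply: eq_bigr => q _; congr (if _ then _ else _); rewrite /in_mem /= /in_set.
rewrite (fsbig_finite _ _ fin_st).
under [RHS]eq_bigr do rewrite exchange_big.
rewrite exchange_big; apply: eq_big_seq => q /=.
rewrite in_fset_set // inE => -[ch sT eE ek].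
(* The chain contains at least one ribbon, which is why the sum stops before j = k. *)
have lt : (#|` q.2| < k)%N.
  rewrite -ek -{1}[#|` q.2|]add0n ltn_add2r.
  apply: leq_trans (chain_cards ch); by case: (q.1) ch.
have [nu enu] := lower_diagram (chain_lower ch).
have nuP : nu \in P by apply: memP; rewrite /contained enu -eE fsubsetUl.
rewrite (bigD1 (Ordinal lt)) //= [X in _ + X]big1 ?addr0; last first.
  move=> j neq; apply: big1 => nu' _; case: asboolP => // -[_ cj].
  by case/eqP: neq; apply: val_inj.
rewrite (big_rem nu) //= big1_seq ?addr0 => [|nu' /= nu'P].
  by case: asboolP => // -[].
case: asboolP => // -[enu' _]; move: nu'P; rewrite mem_rem_uniq // inE.
by rewrite -(diagram_inj (etrans enu' (esym enu))) eqxx.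
Qed.

End Newton.

(** * The Heisenberg operators *)

Section PowerSums.

Local Open Scope ring_scope.

Implicit Types (la : intpart) (s : seq nat).

Lemma intpart_sorted la : sorted geq la.
Proof. by have /andP[] := valP la. Qed.

Lemma intpart_pos la i : i \in (la : seq nat) -> (0 < i)%N.
Proof.
have /andP[_ n0] := valP la; case: i => // i0.
by case/negP: n0.
Qed.

Lemma intpart_perm la la' : perm_eq la la' -> la = la'.
Proof.
move=> pe; apply: val_inj; apply: (sorted_eq _ _ (intpart_sorted la) (intpart_sorted la') pe).
  by move=> a b c; rewrite /geq /= => h h'; apply: leq_trans h' h.
by move=> a b; rewrite /geq /= => h; apply/anti_leq; rewrite andbC.
Qed.

(** The default [la] of [insubd] is returned only for j = 0. *)
Definition insert_part (j : nat) la : intpart := insubd la (sort geq (j :: la)).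

Definition remove_part (j : nat) la : intpart := insubd la (rem j la).

Lemma insert_partE j la : (0 < j)%N -> perm_eq (insert_part j la) (j :: la).
Proof.
move=> j0; rewrite /insert_part val_insubd ifT ?perm_sort //.
rewrite sort_sorted; last by move=> a b; rewrite /geq /=; exact: leq_total.
by rewrite mem_sort inE negb_or (ltn_eqF j0); case/andP: (valP la).
Qed.

Lemma remove_partE j la : perm_eq (remove_part j la) (rem j la).
Proof.
rewrite /remove_part val_insubd ifT //; apply/andP; split.
  apply: (subseq_sorted _ (rem_subseq j la) (intpart_sorted la)).
  by move=> a b c; rewrite /geq /= => h h'; apply: leq_trans h' h.
by apply/negP => /mem_rem /intpart_pos.
Qed.

Lemma insert_partK j la : (0 < j)%N -> remove_part j (insert_part j la) = la.
Proof.
move=> j0; apply: intpart_perm; apply: (perm_trans (remove_partE _ _)).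
have /permP cnt := insert_partE la j0.
have jin : j \in (insert_part j la : seq nat).
  by rewrite (perm_mem (insert_partE la j0)) inE eqxx.
rewrite -(perm_cons j); apply: (perm_trans _ (insert_partE la j0)).
by rewrite perm_sym; exact: perm_to_rem.
Qed.

Lemma remove_partK j la : j \in (la : seq nat) ->
  insert_part j (remove_part j la) = la.
Proof.
move=> jla; apply: intpart_perm.
apply: (perm_trans (insert_partE _ (intpart_pos jla))).
rewrite perm_sym; apply: (perm_trans (perm_to_rem jla)).
by rewrite perm_cons perm_sym; exact: remove_partE.
Qed.

Lemma sumn_insert_part j la : (0 < j)%N ->
  sumn (insert_part j la) = (j + sumn la)%N.
Proof. by move=> j0; rewrite (perm_sumn (insert_partE la j0)). Qed.

Lemma leq_mem_sumn s i : i \in s -> (i <= sumn s)%N.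
Proof.
elim: s => [//|a s IH]; rewrite inE => /orP[/eqP ->|/IH le] /=; first exact: leq_addr.
exact: leq_trans le (leq_addl _ _).
Qed.

Lemma size_sumn s : (forall i, i \in s -> 0 < i)%N -> (size s <= sumn s)%N.
Proof.
elim: s => [//|a s IH] pos /=; rewrite -add1n; apply: leq_add.
  by apply: pos; rewrite inE eqxx.
by apply: IH => i si; apply: pos; rewrite inE si orbT.
Qed.

Lemma finite_parts_le k : finite_set [set la : intpart | (sumn la <= k)%N]%classic.
Proof.
pose A : {fset nat} := [fset i in iota 0 k.+1]%fset.
apply: (sub_finite_set _ (_ : finite_set ((val : intpart -> seq nat) @^-1`
   [set r | (size r <= k)%N && all (mem A) r]))%classic).
  move=> la /= le_k; apply/andP; split.
    by apply: leq_trans le_k; apply: size_sumn => i; exact: intpart_pos.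
  apply/allP => i ila; have -> : mem A i = (i < k.+1)%N := etrans (in_fset _ _ _) (mem_iota 0 k.+1 i).
  by rewrite ltnS (leq_trans (leq_mem_sumn ila)).
apply: finite_preimage; last exact: finite_bounded_seq.
by move=> la la' _ _ /val_inj.
Qed.

Lemma finite_parts k : finite_set [set la : intpart | sumn la = k]%classic.
Proof. by apply: sub_finite_set (finite_parts_le k) => la /= ->. Qed.

Lemma sumn_count s N : (forall i, i \in s -> i < N)%N ->
  sumn s = (\sum_(i < N) i * count_mem (i : nat) s)%N.
Proof.
elim: s => [|a s IH] lt /=; first by rewrite big1 // => i _; rewrite muln0.
rewrite IH; last by move=> i si; apply: lt; rewrite inE si orbT.
under [RHS]eq_bigr do rewrite mulnDr.
rewrite big_split /=; congr addn.
have aN : (a < N)%N by apply: lt; rewrite inE eqxx.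
rewrite (bigD1 (Ordinal aN)) //= eqxx muln1 big1 ?addn0 // => i neq.
by rewrite eq_sym (negbTE (neq : (i : nat) != a)) muln0.
Qed.

Lemma zeeE la N : (forall i, i \in (la : seq nat) -> i < N)%N ->
  zee la = (\prod_(i < N) (i ^ count_mem (i : nat) la * (count_mem (i : nat) la)`!))%N.
Proof.
move=> lt; rewrite /zee.
rewrite -(big_mkord xpredT (fun i => i ^ count_mem i la * (count_mem i la)`!)%N).
rewrite [RHS](bigID (mem (la : seq nat))) /= [X in (_ * X)%N]big1 ?muln1 => [|i ila]; last first.
  by rewrite (count_memPn ila).
rewrite -[RHS]big_filter; apply: perm_big; apply: uniq_perm; rewrite ?undup_uniq //.
  by rewrite filter_uniq // iota_uniq.
move=> i; rewrite mem_undup mem_filter mem_index_iota /=.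
by case ila : (i \in (la : seq nat)); rewrite //= lt.
Qed.

Lemma zee_remove j la : j \in (la : seq nat) ->
  zee la = (j * count_mem j la * zee (remove_part j la))%N.
Proof.
move=> jla; have pj := intpart_pos jla.
have pr := perm_to_rem jla; have pr' := remove_partE j la.
set N := (sumn la).+1.
have lt i : i \in (la : seq nat) -> (i < N)%N by rewrite ltnS; exact: leq_mem_sumn.
have lt' i : i \in (remove_part j la : seq nat) -> (i < N)%N.
  by rewrite (perm_mem pr') => /mem_rem; exact: lt.
rewrite (zeeE lt) (zeeE lt') (bigD1 (Ordinal (lt _ jla))) //=.
rewrite [in RHS](bigD1 (Ordinal (lt _ jla))) //= mulnA; congr muln; last first.
  apply: eq_bigr => i neq; have /permP -> := pr; have /permP -> := pr'.
  by rewrite /= eq_sym (negbTE (neq : (i : nat) != j)).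
have /permP -> := pr; have /permP -> := pr'; rewrite /= eqxx add1n expnS factS.
by rewrite !mulnA; congr muln; rewrite -!mulnA; congr muln; rewrite mulnC.
Qed.

Lemma zee_gt0 la : (0 < zee la)%N.
Proof.
rewrite /zee big_seq prodn_cond_gt0 // => i; rewrite mem_undup => /intpart_pos i0.
by rewrite muln_gt0 expn_gt0 i0 fact_gt0.
Qed.

Variables (F : fieldType) (V : lmodType F) (p : nat -> {linear V -> V}).
Hypothesis char0 : forall m, (m.+1%:R : F) != 0.
Hypothesis comm_p : forall (i j : nat) (v : V), (0 < i)%N -> (0 < j)%N ->
  p i (p j v) = p j (p i v).

Definition pprod s : V -> V := foldr (fun i f => p i \o f) id s.

Lemma pprod_comm s j v : (forall i, i \in s -> 0 < i)%N -> (0 < j)%N ->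
  pprod s (p j v) = p j (pprod s v).
Proof.
move=> pos j0; elim: s pos => [//|i s IH] pos /=.
rewrite IH; last by move=> i' h; apply: pos; rewrite inE h orbT.
by apply: comm_p => //; apply: pos; rewrite inE eqxx.
Qed.

Lemma pprod_rem s j v : (forall i, i \in s -> 0 < i)%N -> j \in s ->
  pprod s v = p j (pprod (rem j s) v).
Proof.
elim: s => [//|i s IH] pos; rewrite inE /=; case: (eqVneq i j) => [-> //|neq /= js].
have pos' i' : i' \in s -> (0 < i')%N by move=> h; apply: pos; rewrite inE h orbT.
rewrite IH //; apply: comm_p; first by apply: pos; rewrite inE eqxx.
exact: pos'.
Qed.

Lemma pprod_perm s s' v : (forall i, i \in s -> 0 < i)%N -> perm_eq s s' ->
  pprod s v = pprod s' v.
Proof.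
elim: s s' => [|i s IH] s' pos pe.
  by move: pe; rewrite perm_sym => /perm_nilP ->.
have is' : i \in s' by rewrite -(perm_mem pe) inE eqxx.
rewrite (@pprod_rem s' i) //=; last by move=> i' h; apply: pos; rewrite (perm_mem pe).
congr (p i _); apply: IH; first by move=> i' h; apply: pos; rewrite inE h orbT.
by rewrite -(perm_cons i); apply: (perm_trans pe); exact: perm_to_rem.
Qed.

Definition hsum k (v : V) : V :=
  \sum_(la \in [set la : intpart | sumn la = k]%classic) (zee la)%:R^-1 *: pprod la v.

Lemma hsum0 v : hsum 0 v = v.
Proof.
have ok : sorted geq [::] && (0%N \notin [::]) by [].
have e : [set la : intpart | sumn la = 0%N]%classic = [set IntPart ok]%classic.
  apply/predeqP => la; split=> /= [s0|->//]; apply: val_inj => /=.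
  apply: size0nil; apply/eqP; rewrite -leqn0 -s0; apply: size_sumn => i.
  exact: intpart_pos.
by rewrite /hsum e fsbig_set1 /zee big_nil invr1 scale1r.
Qed.

(** By [zee_remove] the summand at j is j m_j / z_la, where m_j is the multiplicity of j, and the
    numbers j m_j add up to k. *)
Lemma zee_newton k la : sumn la = k ->
  \sum_(j < k.+1 | (j : nat) \in (la : seq nat)) (zee (remove_part j la))%:R^-1 =
  k%:R * (zee la)%:R^-1 :> F.
Proof.
move=> ek; have z0 la' : (zee la')%:R != 0 :> F.
  by have := zee_gt0 la'; case: (zee la').
have sk : sumn la = (\sum_(i < k.+1) i * count_mem (i : nat) la)%N.
  by apply: sumn_count => i; rewrite ltnS -ek; exact: leq_mem_sumn.
have -> : k%:R = (\sum_(i < k.+1) i * count_mem (i : nat) la)%:R :> F by rewrite -sk ek.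
rewrite natr_sum mulr_suml [RHS](bigID (fun j : 'I_k.+1 => (j : nat) \in (la : seq nat))) /=.
rewrite [X in _ = _ + X]big1 ?addr0 => [|i ila]; last first.
  by rewrite (count_memPn ila) muln0 mul0r.
apply: eq_bigr => j jla; rewrite (zee_remove jla).
have jc : (j * count_mem (j : nat) la)%:R != 0 :> F.
  have : (0 < j * count_mem (j : nat) la)%N.
    by rewrite muln_gt0 (intpart_pos jla) -has_count has_pred1.
  by case: (_ * _)%N.
by rewrite (natrM _ (j * count_mem (j : nat) la)%N) invfM mulrA mulfV // mul1r.
Qed.

(** Compares the coefficients of each product [pprod la]: on the right it arises once for every
    distinct part of [la], and [zee_newton] sums these contributions. *)
Lemma hsum_newton k v :
  k%:R *: hsum k v = \sum_(j < k) p (k - j) (hsum j v).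
Proof.
have fin := finite_parts.
(* Inserting a part j is a bijection from the partitions of k - j to the partitions of k with a part
   j, and it turns a product over the smaller partition into [p j] applied to it. *)
have term (j : nat) : (0 < j <= k)%N -> p j (hsum (k - j) v) =
    \sum_(la <- fset_set [set la : intpart | sumn la = k]%classic)
      (if j \in (la : seq nat) then (zee (remove_part j la))%:R^-1 *: pprod la v else 0).
  move=> /andP[j0 lejk]; rewrite /hsum (fsbig_finite _ _ (fin (k - j)%N)) /= linear_sum /=.
  rewrite -(fsbig_finite _ _ (fin (k - j)%N)) -(fsbig_finite _ _ (fin k)).
  transitivity (\sum_(la \in ([set la : intpart | sumn la = k] `&`
      [set la : intpart | j \in (la : seq nat)])%classic)
      (zee (remove_part j la))%:R^-1 *: pprod la v); last first.
    rewrite fsbig_mkcondr; apply: eq_fsbigr => la _.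
    by congr (if _ then _ else _); rewrite /in_mem /=; apply/asboolP/idP.
  rewrite [RHS](@reindex_fsbig _ _ _ _ _ (insert_part j)
    [set la : intpart | sumn la = (k - j)%N]%classic).
    apply: eq_fsbigr => la _; rewrite insert_partK // linearZ /=; congr (_ *: _).
    rewrite (@pprod_perm (insert_part j la) (j :: la)) //; first by move=> i; exact: intpart_pos.
    exact: insert_partE.
  split.
  - move=> la /= sla; split=> /=; first by rewrite sumn_insert_part // sla subnKC.
    by rewrite (perm_mem (insert_partE la j0)) inE eqxx.
  - by move=> la la' _ _ e; rewrite -(insert_partK la j0) e insert_partK.
  - move=> la [/= sla jla]; exists (remove_part j la); last exact: remove_partK.
    by rewrite /= -sla -{2}(remove_partK jla) sumn_insert_part // addKn.
transitivity (\sum_(j < k.+1 | (0 < j)%N) p j (hsum (k - j) v)); last first.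
  rewrite big_mkcond big_ord_recl /= add0r (reindex_inj rev_ord_inj) /=.
  apply: eq_bigr => j _; rewrite /bump /= add1n subnSK // subKn //.
  by rewrite ltnW.
rewrite (eq_bigr _ (fun (j : 'I_k.+1) j0 => term j _)); last first.
  by move=> j j0; rewrite j0 -ltnS ltn_ord.
rewrite exchange_big /= /hsum (fsbig_finite _ _ (fin k)) scaler_sumr.
apply: eq_big_seq => la; rewrite in_fset_set // inE /= => sla.
rewrite -big_mkcondr /= -scaler_suml scalerA -(zee_newton sla); congr (_ *: _).
by apply: eq_bigl => j; rewrite andb_idl // => /intpart_pos.
Qed.

Lemma hsum_comm k j v : (0 < j)%N -> hsum k (p j v) = p j (hsum k v).
Proof.
move=> j0; rewrite /hsum !(fsbig_finite _ _ (finite_parts k)) /= linear_sum /=.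
apply: eq_bigr => la _; rewrite linearZ pprod_comm // => i; exact: intpart_pos.
Qed.

End PowerSums.

(** * Matrix coefficients on the Fock space *)

Section Fock.

Local Open Scope ring_scope.

Variable R : realType.

Implicit Types (v w : Fock R) (la mu nu : intpart).

Lemma Cq_char0 m : (m.+1%:R : Cq R) != 0.
Proof.
have -> : (m.+1%:R : Cq R) = tofrac (m.+1%:R : {poly (complex R)}) by rewrite rmorph_nat.
by rewrite tofrac_eq0 -polyC_natr polyC_eq0 pnatr_eq0.
Qed.

Lemma ket_coef la mu : (ket R la)@_mu = (la == mu)%:R.
Proof. by rewrite /ket mcoeffU. Qed.

Lemma fock_sum v : v = \sum_(la <- msupp v) v@_la *: ket R la.
Proof.
rewrite {1}[v]monalgE; apply: eq_bigr => la _.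
by apply/malgP => mu; rewrite mcoeffZ ket_coef mcoeffU mulr_natr.
Qed.

Lemma fock_fsum v : v = \sum_(la \in [set: intpart]%classic) v@_la *: ket R la.
Proof.
rewrite [RHS](fsbigTE (msupp v)); first exact: fock_sum.
by move=> la /mcoeff_outdom ->; rewrite scale0r.
Qed.

(** Exchanges the support of [v] for a finite set depending on [mu] only, so that sums for different
    vectors run over the same index set. *)
Lemma fock_extend_coef (f : intpart -> Fock R) v mu (P : {fset intpart}) :
  (forall nu, (f nu)@_mu != 0 -> nu \in P) ->
  (fock_extend f v)@_mu = \sum_(nu <- P) v@_nu * (f nu)@_mu.
Proof.
move=> fP; rewrite /fock_extend raddf_sum /=.
under eq_bigr do rewrite mcoeffZ.
transitivity (\sum_(nu \in [set: intpart]%classic) v@_nu * (f nu)@_mu).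
  by rewrite (fsbigTE (msupp v)) // => nu /mcoeff_outdom ->; rewrite mul0r.
rewrite (fsbigTE P) // => nu; apply: contraNeq => /=.
by rewrite mulf_eq0 negb_or => /andP[_]; exact: fP.
Qed.

Lemma linear_coef (f : {linear Fock R -> Fock R}) v mu (P : {fset intpart}) :
  (forall nu, v@_nu != 0 -> nu \in P) ->
  (f v)@_mu = \sum_(nu <- P) v@_nu * (f (ket R nu))@_mu.
Proof.
move=> vP; rewrite {1}[v]fock_sum linear_sum raddf_sum /=.
under eq_bigr do rewrite linearZ mcoeffZ.
transitivity (\sum_(nu \in [set: intpart]%classic) v@_nu * (f (ket R nu))@_mu).
  by rewrite (fsbigTE (msupp v)) // => nu /mcoeff_outdom ->; rewrite mul0r.
rewrite (fsbigTE P) // => nu; apply: contraNeq => /=.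
by rewrite mulf_eq0 negb_or => /andP[h _]; exact: vP.
Qed.

Lemma fsum_ket_coef (A : set intpart) (c : intpart -> Cq R) mu : finite_set A ->
  (\sum_(nu \in A) c nu *: ket R nu)@_mu = if `[< A mu >] then c mu else 0.
Proof.
move=> finA; rewrite (fsbig_finite _ _ finA) raddf_sum /=.
under eq_bigr do rewrite mcoeffZ ket_coef.
case: asboolP => Amu.
  have muA : mu \in fset_set A by rewrite in_fset_set // ?inE.
  rewrite (big_fsetD1 mu) //= eqxx mulr1 big1_seq ?addr0 // => nu /= nuA.
  move: nuA; rewrite in_fsetD1 => /andP[/negbTE -> _].
  by rewrite mulr0.
rewrite big1_seq // => nu /=; rewrite in_fset_set // => /set_mem Anu.
by case: eqP => [e|]; [case: Amu; rewrite -e|rewrite mulr0].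
Qed.

Lemma finite_contained mu : finite_set [set nu | contained nu mu]%classic.
Proof.
apply: (sub_finite_set _ (_ : finite_set (diagram @^-1`
  [set` fpowerset (diagram mu)])%classic)).
  by move=> nu /= sub; rewrite fpowersetE.
apply: finite_preimage; last exact: finite_fset.
by move=> nu nu' _ _ /diagram_inj.
Qed.

Variables (n : nat) (n_gt0 : (0 < n)%N).

(** Adding [k] ribbons of [n] squares bounds the size of the new partition. *)
Lemma finite_hstrip_above k la :
  finite_set [set mu | is_hstrip n k mu la]%classic.
Proof.
apply: sub_finite_set (finite_parts_le (sumn la + n * k)) => mu [T [hT cT]] /=.
have [sT emu] := proj1 (hstrip_tilingE n mu la T) hT.
rewrite -!card_diagram emu cardfsU.
apply: (leq_trans (leq_subr _ _)); rewrite leq_add2l.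
have le_area : (#|` area T| <= \sum_(S <- T) #|` S|)%N.
  rewrite /area; elim/big_rec2: _ => [|S m A _ le]; first by rewrite cardfs0.
  by rewrite cardfsU; apply: (leq_trans (leq_subr _ _)); rewrite leq_add2l.
apply: (leq_trans le_area).
have -> : (\sum_(S <- T) #|` S| = \sum_(S <- T) n)%N.
  by apply: eq_big_seq => S ST; exact: (ribbon_card (strip_ribbon sT ST)).
by rewrite big_const_seq count_predT iter_addn_0 cT.
Qed.

Lemma finite_hstrip_below k mu :
  finite_set [set nu | is_hstrip n k mu nu]%classic.
Proof.
by apply: sub_finite_set (finite_contained mu) => nu [T [[sub _ _] _]].
Qed.

Let t : Cq R := - (qvar R)^-1.

Let two_neq0 : (2%:R : Cq R) != 0 := Cq_char0 1.

Lemma qvar_powers m : (- qvar R) ^- m = t ^+ m.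
Proof. by rewrite -exprVn invrN. Qed.

Lemma fock_extend_ket (f : intpart -> Fock R) la : fock_extend f (ket R la) = f la.
Proof.
rewrite /fock_extend; have -> : msupp (ket R la) = [fset la]%fset.
  by rewrite msuppU oner_eq0.
by rewrite big_seq_fset1 ket_coef eqxx scale1r.
Qed.

Lemma calV_ket k la mu : (calV n k (ket R la))@_mu = hcoef n t k mu la.
Proof.
rewrite /calV fock_extend_ket (fsum_ket_coef _ _ (finite_hstrip_above k la)).
by rewrite qvar_powers.
Qed.

Lemma calU_ket k la mu : (calU n k (ket R la))@_mu = hcoef n t k la mu.
Proof.
rewrite /calU fock_extend_ket (fsum_ket_coef _ _ (finite_hstrip_below k la)).
by rewrite qvar_powers.
Qed.

Lemma calV_coef k v mu (P : {fset intpart}) :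
  (forall nu, contained nu mu -> nu \in P) ->
  (calV n k v)@_mu = \sum_(nu <- P) v@_nu * hcoef n t k mu nu.
Proof.
move=> memP; rewrite {1}/calV (@fock_extend_coef _ _ _ P) => [|nu].
  by apply: eq_bigr => nu _; rewrite -calV_ket /calV fock_extend_ket.
by have := calV_ket k nu mu; rewrite /calV fock_extend_ket => -> /hcoef_contained/memP.
Qed.

Variables (B : operators R) (B_action : heisenberg_action n B).

Let lower_op (i : nat) : {linear Fock R -> Fock R} := B (- i%:Z).
Let raise_op (i : nat) : {linear Fock R -> Fock R} := B i%:Z.

Lemma lower_op_comm (i j : nat) v : (0 < i)%N -> (0 < j)%N ->
  lower_op i (lower_op j v) = lower_op j (lower_op i v).
Proof.
move=> i0 j0; rewrite /lower_op.
by apply: (heisenberg_commute B_action); lia.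
Qed.

Lemma raise_op_comm (i j : nat) v : (0 < i)%N -> (0 < j)%N ->
  raise_op i (raise_op j v) = raise_op j (raise_op i v).
Proof.
move=> i0 j0; rewrite /raise_op.
by apply: (heisenberg_commute B_action); lia.
Qed.

Lemma sum_hcoef0 (f : intpart -> Cq R) mu (P : {fset intpart}) :
  (forall nu, contained nu mu -> nu \in P) ->
  \sum_(nu <- P) f nu * hcoef n t 0 mu nu = f mu.
Proof.
move=> memP; under eq_bigr do rewrite (hcoef0 n_gt0).
have muP : mu \in P by apply: memP; rewrite /contained fsubset_refl.
rewrite (big_fsetD1 mu) //= eqxx mulr1 big1_seq ?addr0 // => nu /= nuP.
move: nuP; rewrite in_fsetD1 eq_sym => /andP[/negbTE -> _].
by rewrite mulr0.
Qed.

Lemma hsum_lower k v mu (P : {fset intpart}) :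
  (forall nu, contained nu mu -> nu \in P) ->
  (hsum lower_op k v)@_mu = \sum_(nu <- P) v@_nu * hcoef n t k mu nu.
Proof.
move=> memP; case: k => [|k]; first by rewrite hsum0 sum_hcoef0.
by rewrite -(calV_coef _ _ memP) (heisenberg_V B_action).
Qed.

Lemma hsum_raise k la mu :
  (hsum raise_op k (ket R la))@_mu = hcoef n t k la mu.
Proof.
case: k => [|k]; first by rewrite hsum0 ket_coef (hcoef0 n_gt0).
by rewrite -calU_ket (heisenberg_U B_action).
Qed.

(** Both the operators and the border strip counts satisfy Newton's identity with the same left
    side. By induction the terms with j > 0 agree, and those with j = 0 are the two sides of the
    claim. *)
Lemma lower_coef k la mu : (0 < k)%N ->
  (B (- k%:Z) (ket R la))@_mu = calX n k mu la t.
Proof.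
elim/ltn_ind: k la mu => -[//|k] IH la mu _.
pose P := fset_set [set nu | contained nu mu]%classic.
have memP nu : contained nu mu -> nu \in P.
  by move=> sub; rewrite in_fset_set; [exact: mem_set|exact: finite_contained].
have eqV : k.+1%:R * hcoef n t k.+1 mu la =
    \sum_(j < k.+1) \sum_(nu <- P)
      (B (- (k.+1 - j)%N%:Z) (ket R la))@_nu * hcoef n t j mu nu.
  have -> : hcoef n t k.+1 mu la = (hsum lower_op k.+1 (ket R la))@_mu.
    by rewrite -calV_ket (heisenberg_V B_action).
  rewrite -mcoeffZ (hsum_newton Cq_char0 lower_op_comm) raddf_sum /=.
  (* Commuting lets the horizontal strip operator act last, so that the border strip starts at [la]
     and the horizontal strip ends at [mu], as in [hcoef_newton]. *)
  apply: eq_bigr => j _; rewrite -(hsum_comm lower_op_comm); last by rewrite subn_gt0.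
  by rewrite (hsum_lower _ _ memP).
have := hcoef_newton n_gt0 t two_neq0 k.+1 la (fset_uniq P) memP.
rewrite eqV !big_ord_recl !subn0.
rewrite [X in _ + X = _](_ : _ = \sum_(i < k) \sum_(nu <- P)
   hcoef n t (lift ord0 i) mu nu * calX n (k.+1 - lift ord0 i) nu la t); last first.
  apply: eq_bigr => i _; apply: eq_bigr => nu _; rewrite mulrC IH //.
    by rewrite /= /bump; lia.
  by rewrite /= /bump; have := ltn_ord i; lia.
move/addIr.
rewrite (sum_hcoef0 _ memP); under [in RHS]eq_bigr do rewrite mulrC.
by rewrite (sum_hcoef0 _ memP).
Qed.

(** The same induction with inner and outer shape exchanged. The horizontal strip is now removed
    first, from the outside, so the order of operators in [hsum_newton] is already the right one. *)
Lemma raise_coef k la mu : (0 < k)%N ->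
  (B k%:Z (ket R la))@_mu = calX n k la mu t.
Proof.
elim/ltn_ind: k la mu => -[//|k] IH la mu _.
pose P := fset_set [set nu | contained nu la]%classic.
have memP nu : contained nu la -> nu \in P.
  by move=> sub; rewrite in_fset_set; [exact: mem_set|exact: finite_contained].
have eqU : k.+1%:R * hcoef n t k.+1 la mu =
    \sum_(j < k.+1) \sum_(nu <- P)
      hcoef n t j la nu * (B (k.+1 - j)%N%:Z (ket R nu))@_mu.
  rewrite -calU_ket (heisenberg_U B_action) // -[X in X@_mu]/(hsum raise_op k.+1 (ket R la)).
  rewrite -mcoeffZ (hsum_newton Cq_char0 raise_op_comm) raddf_sum /=.
  apply: eq_bigr => j _; rewrite (@linear_coef _ _ _ P) => [|nu].
    by apply: eq_bigr => nu _; rewrite hsum_raise.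
  by rewrite hsum_raise => /hcoef_contained/memP.
have := hcoef_newton n_gt0 t two_neq0 k.+1 mu (fset_uniq P) memP.
rewrite eqU !big_ord_recl !subn0.
rewrite [X in _ + X = _](_ : _ = \sum_(i < k) \sum_(nu <- P)
   hcoef n t (lift ord0 i) la nu * calX n (k.+1 - lift ord0 i) nu mu t); last first.
  apply: eq_bigr => i _; apply: eq_bigr => nu _; rewrite IH //.
    by rewrite /= /bump; lia.
  by rewrite /= /bump; have := ltn_ord i; lia.
move/addIr.
under eq_bigr do rewrite mulrC; under [in RHS]eq_bigr do rewrite mulrC.
by rewrite !(sum_hcoef0 _ memP).
Qed.

End Fock.

Theorem proposition6 (R : realType) (n : nat) (n_ge1 : (1 <= n)%N)
    (B : operators R) (B_action : heisenberg_action n B)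
    (k : nat) (k_ge1 : (1 <= k)%N) (la : intpart) :
  (B (- k%:Z) (ket R la) =
     \sum_(mu \in [set: intpart]) (calX n k mu la (- (qvar R)^-1) *: ket R mu) /\
   B k%:Z (ket R la) =
     \sum_(mu \in [set: intpart]) (calX n k la mu (- (qvar R)^-1) *: ket R mu))%R.
Proof.
split; rewrite [LHS]fock_fsum; apply: eq_fsbigr => mu _; congr (_ *: _)%R.
  exact: (lower_coef n_ge1 B_action).
exact: (raise_coef n_ge1 B_action).
Qed.
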